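(* Let $\lambda\in(0,2d)$ and let $u:\mathbb{Z}^d\to\mathbb{C}$ satisfy $\sum_{|x|<r}|u_x|^2=o(r)$ as $r\to\infty$. Let $(\Delta-\lambda)u=f$ on $\mathbb{Z}^d$, where $(e^{t|x|}f_x)_{x\in\mathbb{Z}^d}\in\ell^2(\mathbb{Z}^d)$ for all $t>0$. (i) If $f|_{Y_d(z)}=0$ for some $z\in\mathbb{Z}$, then $u|_{Y_d(z)}=0$. (ii) If $E=\mathbb{Z}^d\setminus Q(m)$ for some $m\in\mathbb{N}^d$ and $f|_{E}=0$, then $u|_{E}=0$.
   Context: $d\ge 1$ is an integer. $\Delta$ is the combinatorial Laplacian on $\mathbb{Z}^d$ (graph with edges joining points at Euclidean distance $1$): $(\Delta f)_x=\sum_{y\sim x}(f_x-f_y)$, where $y$ runs over the $2d$ nearest neighbours of $x$; it acts on arbitrary functions $\mathbb{Z}^d\to\mathbb{C}$. Half-space: $Y_j(z)=\{x\in\mathbb{Z}^d: x_j\ge z\}$. Cuboid: $Q(m)=\{x\in\mathbb{Z}^d: 0\le x_j\le m_j,\ j=1,\dots,d\}$ for $m=(m_j)\in\mathbb{N}^d$. *)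

(* Defs.v *)
From HB Require Import structures.
From mathcomp Require Import all_boot all_order all_algebra.
From mathcomp Require Import all_classical all_reals all_analysis.
From mathcomp Require Import complex.
Import Order.TTheory GRing.Theory Num.Theory.
Import numFieldNormedType.Exports.

Set Implicit Arguments.
Unset Strict Implicit.
Unset Printing Implicit Defensive.

Local Open Scope classical_set_scope.
Local Open Scope ring_scope.
Local Open Scope complex_scope.

Notation lattice d := 'rV[int]_d.

Definition last_coord (d : nat) (hd : (0 < d)%N) : 'I_d :=
  Ordinal (etrans (ltn_predL d) hd).

(* The filter of neighbourhoods of +oo, packaged so that f =o_ (at_pinfty R) g is
   accepted. *)
Definition at_pinfty (R : realType) : filter_on R :=
  FilterType (pinfty_nbhs R) _.

Section Lattice.
Variables (R : realType) (d : nat).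
Implicit Types (x y : lattice d) (u g : lattice d -> R[i]).

Definition lnorm x : R := Num.sqrt (\sum_(j < d) (x ord0 j)%:~R ^+ 2).

Definition lball (r : R) : set (lattice d) := [set x | lnorm x < r].

Definition neighbours x : set (lattice d) := [set y | lnorm (x - y) = 1].

(* A finitely supported sum over a set is 0 by convention when the support is
   infinite; lball_finite and neighbours_finite below exclude this case for the
   sums in laplacian and in mass. *)
Definition laplacian u : lattice d -> R[i] :=
  fun x => \sum_(y \in neighbours x) (u x - u y).

Definition sqmod (z : R[i]) : R := ComplexField.Normc.normc z ^+ 2.

Definition mass u (r : R) : R := \sum_(x \in lball r) sqmod (u x).

Definition square_summable g : Prop :=
  summable [set: lattice d] (fun x => (sqmod (g x))%:E).

Definition super_exp_decay g : Prop :=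
  forall t : R, 0 < t ->
    square_summable (fun x => (expR (t * lnorm x))%:C * g x).

End Lattice.

Definition halfspace (d : nat) (j : 'I_d) (z : int) : set (lattice d) :=
  [set x | z <= x ord0 j].

Definition cuboid (d : nat) (m : 'I_d -> nat) : set (lattice d) :=
  [set x | forall j, 0 <= x ord0 j <= (m j)%:Z].

Lemma lball_finite (R : realType) (d : nat) (r : R) : finite_set (@lball R d r).
Proof.
pose N := (Num.truncn `|r|).+1.
pose h (k : 'I_(N + N)) : int := (k : nat)%:Z - N%:Z.
pose g (s : {ffun 'I_d -> 'I_(N + N)}) : lattice d := \row_j h (s j).
apply: (@sub_finite_set _ _ (g @` setT)); last first.
  by apply: finite_image; exact: finite_finset.
move=> x /= xr.
have xN j : `|x ord0 j| < N%:Z.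
  rewrite -(ltr_int R) intr_norm.
  apply: (@le_lt_trans _ _ `|r|); last by rewrite /N truncnS_gt.
  apply: (le_trans _ (ler_norm r)); apply: (le_trans _ (ltW xr)).
  rewrite -sqrtr_sqr /lnorm ler_sqrt; last by apply: sumr_ge0 => i _; exact: sqr_ge0.
  by rewrite (bigD1 j) //= lerDl; apply: sumr_ge0 => i _; exact: sqr_ge0.
have kP j : (absz (x ord0 j + N%:Z)%R < N + N)%N.
  have := xN j; rewrite ltr_norml => /andP[a b].
  rewrite -ltz_nat gez0_abs; last by rewrite -lerBlDr sub0r ltW.
  by rewrite PoszD ltrD2r.
exists [ffun j => Ordinal (kP j)] => //.
apply/rowP => j; rewrite mxE ffunE /h /= gez0_abs ?addrK //.
have := xN j; rewrite ltr_norml => /andP[a _].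
by rewrite -lerBlDr sub0r ltW.
Qed.

Lemma neighbours_finite (R : realType) (d : nat) (x : lattice d) :
  finite_set (neighbours R x).
Proof.
apply: (@sub_finite_set _ _ ((fun v : lattice d => x - v) @` lball 2%R)); last first.
  by apply: finite_image; exact: (@lball_finite R).
move=> y /= xy; exists (x - y); last by rewrite subKr.
by rewrite /lball /= xy ltr1n.
Qed.

(* Main.v *)
Require Import Defs.
From mathcomp Require Import all_boot all_order all_algebra.
From mathcomp Require Import all_classical all_reals all_analysis.
From mathcomp Require Import complex.
From mathcomp Require Import ring lra zify.
Import Order.TTheory GRing.Theory Num.Theory.
Import numFieldNormedType.Exports.
Import ComplexField.Normc.

Local Open Scope classical_set_scope.
Local Open Scope ring_scope.
Local Open Scope complex_scope.

Set Implicit Arguments.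
Unset Strict Implicit.
Unset Printing Implicit Defensive.

(** The theorem is proved with finite sums only.

    Up to permuting and reflecting the axes, the half-space is [n >= 0], where
    [n] is one coordinate and the others, [x], range over a slice. On slices
    the equation reads [U (n+1) + U (n-1) = 2 A (U n) + F n], with [A] = [hop]
    a difference operator in [x] and [F n = 0] for [n >= 0]. A Fourier
    transform in [x] turns [A] into multiplication by a real trigonometric
    polynomial [c] = [symbol], and leaves at each frequency a scalar
    three-term recurrence with characteristic roots [a], [b], where
    [a b = 1] and [a + b = 2 c].

    - [U] need not be summable over a slice, so it is first multiplied by a
      cutoff that is Lipschitz with constant [1 / N]. This adds to [F] a
      source whose square sum is [o(1 / N)] ([err_mass]). By Parseval on a
      finite grid of frequencies and Cauchy-Schwarz over the [O(N)] slices,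
      the absolute sum of this source over all slices tends to zero in mean
      square over the frequencies ([errsum_average]).

    - Where [|c| < 1] both roots have modulus one, and a finitely supported
      solution can exist only if the source is orthogonal to the powers of
      both roots. So the sums of the transformed [F] against these powers
      tend to zero there ([rec_oscillating], [extrap_ball]): no energy is
      radiated at real frequencies.

    - A power of a root is affine in the root, with Chebyshev polynomials of
      [c] as coefficients. Hence the two orthogonality relations amount to
      the vanishing of two functions which are entire in the frequency,
      because [F] decays faster than every exponential. As they vanish on an
      open set they vanish everywhere; [expsum_continuation] is the
      quantitative form of this step, with constants independent of [N]
      ([extrap_uniform]). The open set exists since
      [0 < lambda < 2 d].

    - At every frequency there is a root of modulus at most one. Solving from
      the right with it, and from the left with its inverse while using the
      orthogonality, bounds [(c ^+ 2 - 1)] times the transform of each slice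
      [n >= 0] ([rec_bound]). In the limit [A (A (U n)) = U n] for [n >= 0]
      ([hop_hop]).

    - Together with the equation this gives [U (n+2) - 2 U n + U (n-2) = 0]
      along each ray, so [U] is affine along steps of two, and the growth
      hypothesis forces it to vanish ([slice_eq0]).

    The second part follows because the complement of a cuboid is a union of
    half-spaces on which the right-hand side vanishes. *)

(** * Complex modulus and the unit circle *)

Section Modulus.
Variable R : realType.
Implicit Types z w : R[i].

Lemma normc_ge0 z : 0 <= normc z.
Proof. by case: z => a b /=; exact: sqrtr_ge0. Qed.

Lemma normcNE z : normc (- z) = normc z.
Proof. exact: normcN. Qed.

Lemma ler_normcD z w : normc (z + w) <= normc z + normc w.
Proof. exact: le_normcD. Qed.

Lemma ler_normcB z w : normc (z - w) <= normc z + normc w.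
Proof. by rewrite -[leRHS](congr1 (+%R _) (normcNE w)); exact: ler_normcD. Qed.

Lemma normc_real (x : R) : normc x%:C = `|x|.
Proof. by rewrite /= expr0n addr0 sqrtr_sqr. Qed.

Lemma normcX z n : normc (z ^+ n) = normc z ^+ n.
Proof.
elim: n => [|n IH]; first by rewrite !expr0 normc1.
by rewrite !exprS normcM IH.
Qed.

Lemma normc_nat n : normc (n%:R : R[i]) = n%:R.
Proof. by rewrite -(rmorph_nat (@real_complex R)) normc_real ger0_norm. Qed.

Lemma ler_normc_sum (I : Type) (s : seq I) (P : pred I) (F : I -> R[i]) :
  normc (\sum_(i <- s | P i) F i) <= \sum_(i <- s | P i) normc (F i).
Proof.
elim/big_ind2: _ => [|z a w b Ha Hb|//]; first by rewrite normc0.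
exact: le_trans (ler_normcD _ _) (lerD Ha Hb).
Qed.

Lemma normc_mul_conj z : z * z^* = (normc z ^+ 2)%:C.
Proof. by rewrite -sqr_normc normc_def -rmorphXn; case: z. Qed.

Definition cis (t : R) : R[i] := cos t +i* sin t.

Lemma cisD s t : cis (s + t) = cis s * cis t.
Proof. by apply/eqP; rewrite eq_complex /= cosD sinD [_ * cos t]mulrC
  [cos s * sin t + _]addrC mulrC [sin s * _]mulrC !eqxx. Qed.

Lemma cis0 : cis 0 = 1.
Proof. by rewrite /cis cos0 sin0. Qed.

Lemma cisN t : cis (- t) = (cis t)^*.
Proof. by rewrite /cis cosN sinN. Qed.

Lemma normc_cis t : normc (cis t) = 1.
Proof. by rewrite /= cos2Dsin2 sqrtr1. Qed.

Lemma cisMn t n : cis (n%:R * t) = cis t ^+ n.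
Proof.
elim: n => [|n IH]; first by rewrite mul0r cis0 expr0.
by rewrite exprS -IH -cisD -natr1 mulrDl mul1r addrC.
Qed.

Lemma cisDcisN t : cis t + cis (- t) = (2 * cos t)%:C.
Proof. by apply/eqP; rewrite cisN eq_complex /= subrr mulr_natl mulr2n !eqxx. Qed.

Lemma cis2pi : cis (2 * pi) = 1.
Proof. by rewrite /cis mulr_natl cos2pi sin2pi. Qed.

Lemma cis_int2pi (n : int) : cis (n%:~R * (2 * pi)) = 1.
Proof.
case: n => n; first by rewrite -[_%:~R]/(n%:R : R) cisMn cis2pi expr1n.
rewrite NegzE mulrNz mulNr cisN -[_%:~R]/(n.+1%:R : R) cisMn cis2pi expr1n.
by rewrite conjc1.
Qed.

Lemma cos_lip (s t : R) : `|cos t - cos s| <= `|t - s|.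
Proof.
wlog st : s t / s <= t => [H|].
  by have [/H//|/ltW/H] := leP s t; rewrite distrC [leRHS]distrC.
have [|c _ ->] := @MVT_segment R (@cos R) (fun x => - sin x) s t st.
  by apply: continuous_subspaceT => x; exact: continuous_cos.
by rewrite normrM normrN ler_piMl // sin_max.
Qed.

Lemma sin_lip (t : R) : `|sin t| <= `|t|.
Proof.
rewrite -[sin t](cosBpihalf) -[leRHS](_ : `|t - pi / 2 - (- (pi / 2))| = `|t|); last first.
  by congr `| _ |; ring.
by have := cos_lip (- (pi / 2)) (t - pi / 2); rewrite cosN cos_pihalf subr0.
Qed.

(** The chord is shorter than the arc. *)
Lemma normc_cisB1 (t : R) : normc (cis t - 1) <= `|t|.
Proof.
rewrite /= -[leRHS]sqrtr_sqr ler_sqrt ?sqr_ge0 // oppr0 addr0.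
have -> : (cos t - 1) ^+ 2 + sin t ^+ 2 = 4 * sin (t / 2) ^+ 2.
  have -> : (cos t - 1) ^+ 2 + sin t ^+ 2 = (cos t ^+ 2 + sin t ^+ 2) + 1 - 2 * cos t by ring.
  rewrite cos2Dsin2 [in LHS](_ : t = t / 2 *+ 2); last by rewrite mulr2n; field.
  by rewrite cos_mulr2n sin2cos2; ring.
have : `|sin (t / 2)| ^+ 2 <= `|t / 2| ^+ 2 by rewrite ler_sqr ?nnegrE // sin_lip.
rewrite !real_normK ?num_real //; lra.
Qed.

Lemma normc_cisB (s t : R) : normc (cis s - cis t) <= `|s - t|.
Proof.
rewrite -{1}(subrK t s) cisD -{2}(mul1r (cis t)) -mulrBl normcM normc_cis mulr1.
exact: normc_cisB1.
Qed.

Lemma cis_neq1 (t : R) : 0 < t < 2 * pi -> cis t != 1.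
Proof.
move=> t02; apply/eqP => /(congr1 (@complex.Re R)) /=.
rewrite [in cos _](_ : t = t / 2 *+ 2); last by rewrite mulr2n; field.
have : 0 < sin (t / 2) by apply: sin_gt0_pi; lra.
have := sin2cos2 (t / 2); rewrite cos_mulr2n [_ *+ 2]mulr2n; nra.
Qed.

(** For [n] nonzero this is a complete geometric sum of a nontrivial [K]-th
root of unity. *)
Lemma sum_cis_roots (K : nat) (n : int) : (`|n| < K)%N ->
  \sum_(a < K) cis (n%:~R * (2 * pi * a%:R / K%:R)) = (if n == 0 then K%:R else 0).
Proof.
move=> nK; have K0 : (0 < K)%N by exact: leq_ltn_trans nK.
have K0R : (0 : R) < K%:R by rewrite ltr0n.
have [->|n0] := eqVneq n 0.
  under eq_bigr do rewrite mul0r cis0.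
  by rewrite sumr_const card_ord.
pose w := cis (n%:~R * (2 * pi / K%:R)).
under eq_bigr => a _.
  rewrite (_ : n%:~R * (2 * pi * a%:R / K%:R) = a%:R * (n%:~R * (2 * pi / K%:R))); last by ring.
  rewrite cisMn -/w. over.
have w1 : w - 1 != 0.
  have H m : (0 < m < K)%N -> cis (m%:R * (2 * pi / K%:R)) != 1.
    case/andP=> m0 mK; apply: cis_neq1; have p0 := @pi_gt0 R.
    rewrite -(ltr0n R) in m0; rewrite -(ltr_nat R) in mK.
    rewrite mulr_gt0 // ?divr_gt0 ?mulr_gt0 //=.
    by rewrite mulrCA gtr_pMr ?mulr_gt0 // ltr_pdivrMr // mul1r.
  rewrite subr_eq0 /w; case: n nK n0 {w} => m /= nK n0.
    by apply: H; rewrite nK andbT lt0n; apply: contra n0 => /eqP ->.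
  rewrite NegzE mulrNz mulNr cisN; apply/eqP => /(congr1 (@conjc R)).
  by rewrite conjcK conjc1; apply/eqP; exact: H.
apply: (mulfI w1); rewrite mulr0.
have -> : (w - 1) * \sum_(i < K) w ^+ i = w ^+ K - 1 by rewrite subrX1.
rewrite -cisMn (_ : K%:R * _ = n%:~R * (2 * pi)); last by field; rewrite gt_eqF.
by rewrite cis_int2pi subrr.
Qed.

End Modulus.

(** * The scalar three-term recurrence *)

Section Recurrence.
Variable R : realType.
Local Notation C := R[i].

(** Solutions of the Chebyshev recurrence with arbitrary first two values:
[cheb 0 1] and [cheb 1 0] are, up to sign and an index shift, the Chebyshev
polynomials of the second kind in [c]. *)
Definition cheb (x0 x1 c : C) (n : nat) : C :=
  (iter n (fun p => (p.2, 2 * c * p.2 - p.1)) (x0, x1)).1.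

Lemma chebS2 x0 x1 c n :
  cheb x0 x1 c n.+2 = 2 * c * cheb x0 x1 c n.+1 - cheb x0 x1 c n.
Proof. by []. Qed.

(** Both sides solve [y_(n+2) = 2 c y_(n+1) - y_n] with the same first two
values. The point of the splitting is that the coefficients are polynomials in
[c]: unlike the roots they have no branch point at [c = 1] and [c = -1], which
is what makes analytic continuation in the frequency possible. *)
Lemma expr_cheb (a b c : C) n : a * b = 1 -> a + b = 2 * c ->
  a ^+ n = a * cheb 0 1 c n + cheb 1 0 c n.
Proof.
move=> ab1 abc; have a2 : a ^+ 2 = 2 * c * a - 1 by rewrite -abc -ab1; ring.
suff [] : a ^+ n = a * cheb 0 1 c n + cheb 1 0 c n /\
  a ^+ n.+1 = a * cheb 0 1 c n.+1 + cheb 1 0 c n.+1 by [].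
elim: n => [|n [IH1 IH2]]; first by rewrite /cheb /= !mulr0 !mulr1 expr0 add0r addr0.
split=> //; rewrite !chebS2.
have -> : a ^+ n.+2 = 2 * c * a ^+ n.+1 - a ^+ n.
  by rewrite !exprS mulrA -expr2 a2; ring.
by rewrite IH1 IH2; ring.
Qed.

(** Split along the constructors of [int] because every estimate treats the
two half-lines separately. *)
Definition zsum (V : nmodType) (K : nat) (g : int -> V) : V :=
  \sum_(i < K) g (Posz i) + \sum_(i < K) g (Negz i).

Variables (L : nat) (v e g : int -> C) (x : R).
Hypothesis v0 : forall n, (L <= `|n|)%N -> v n = 0.
Hypothesis veq : forall n, v (n + 1) + v (n - 1) - 2 * x%:C * v n = e n + g n.
Hypothesis g0 : forall n, 0 <= n -> g n = 0.

Let E : R := zsum L.+1 (fun n => normc (e n)).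
Let X : C := \sum_(j < L.+1) cheb 0 1 x%:C j * g (Negz j).
Let Y : C := \sum_(j < L.+1) cheb 1 0 x%:C j * g (Negz j).

(** If [a] and [b] are the characteristic roots, [v (n+1) - a v n] solves a
first order recurrence whose multiplier towards decreasing [n] is [a]. Started
beyond the support of [v], where it is zero, it only collects the source on
its way down, and for [n >= 0] that source is [e]. *)
Lemma rec_from_above (a b : C) (n : nat) : a * b = 1 -> a + b = 2 * x%:C ->
  normc a <= 1 ->
  normc (v n%:Z - a * v (n%:Z - 1)) <= \sum_(i < L.+1) normc (e (Posz i)).
Proof.
move=> ab1 abc a1.
have step m : v m - a * v (m - 1) = a * (v (m + 1) - a * v m - (e m + g m)).
  have a2 : a * a = 2 * x%:C * a - 1 by rewrite -abc -ab1; ring.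
  rewrite -veq; transitivity (a * (2 * x%:C * v m - v (m - 1)) - a * a * v m); last by ring.
  by rewrite a2; ring.
have main m : (m <= L.+1)%N -> normc (v (L.+1 - m)%:Z - a * v ((L.+1 - m)%:Z - 1)) <=
    \sum_((L.+1 - m)%N <= i < L.+1) normc (e (Posz i)).
  elim: m => [_|m IH mL].
    rewrite subn0 big_geq // !v0 ?mulr0 ?subrr ?normc0 //; lia.
  have {}IH := IH (ltnW mL).
  rewrite big_ltn; last by lia.
  have Em : (L.+1 - m.+1).+1 = (L.+1 - m)%N by lia.
  have Ez : (L.+1 - m.+1)%:Z + 1 = (L.+1 - m)%:Z by lia.
  have Ez' : (L.+1 - m.+1)%:Z = (L.+1 - m)%:Z - 1 by lia.
  rewrite Em step Ez g0 ?addr0 //.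
  apply: (@le_trans _ _ (1 * normc (v (L.+1 - m)%:Z - a * v (L.+1 - m.+1)%:Z - e (L.+1 - m.+1)%:Z))).
    by rewrite normcM ler_pM // normc_ge0.
  rewrite mul1r (le_trans (ler_normcB _ _)) // addrC lerD2l Ez'; exact: IH.
have [nL|nL] := leqP n L.+1.
  have := main (L.+1 - n)%N; rewrite subKn // => /(_ (leq_subr _ _))/le_trans; apply.
  rewrite -(big_mkord xpredT (fun i => normc (e (Posz i)))) [leRHS](big_cat_nat _ nL) //= lerDr.
  by apply: sumr_ge0 => i _; exact: normc_ge0.
rewrite !v0 ?mulr0 ?subrr ?normc0 //; try lia.
by apply: sumr_ge0 => i _; exact: normc_ge0.
Qed.

(** The same factorisation, run upwards from the far left. The source [g] now
enters through its sum against the powers of [a], which [expr_cheb] splits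
into the combination [a X + Y]. *)
Lemma rec_from_below (a b : C) : a * b = 1 -> a + b = 2 * x%:C -> normc a <= 1 ->
  normc (v 0 - b * v (- 1) - (a * X + Y)) <= \sum_(i < L.+1) normc (e (Negz i)).
Proof.
move=> ab1 abc a1.
have step m : v (m + 1) - b * v m = a * (v m - b * v (m - 1)) + (e m + g m).
  rewrite -veq -abc; transitivity (v (m + 1) - (a + b) * v m + a * v m); first by ring.
  by rewrite mulrBr mulrA ab1; ring.
have main m : v 0 - b * v (- 1) = a ^+ m * (v (1 + Negz m) - b * v (Negz m)) +
   \sum_(j < m) a ^+ j * (e (Negz j) + g (Negz j)).
  elim: m => [|m IH]; first by rewrite big_ord0 expr0 mul1r addr0.
  rewrite IH big_ord_recr /= [1 + _]addrC step.
  have -> : Negz m - 1 = Negz m.+1 by lia.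
  have -> : 1 + Negz m.+1 = Negz m by lia.
  by rewrite exprSr; ring.
rewrite (main L.+1) !v0 ?mulr0 ?subrr ?mulr0 ?add0r; try lia.
have -> : a * X + Y = \sum_(j < L.+1) a ^+ j * g (Negz j).
  rewrite mulr_sumr -big_split /=; apply: eq_bigr => j _.
  by rewrite (expr_cheb _ ab1 abc); ring.
rewrite -sumrB (le_trans (ler_normc_sum _ _ _)) //; apply: ler_sum => j _.
rewrite -mulrBr addrK normcM normcX ler_piMl ?normc_ge0 //.
by rewrite exprn_ile1 ?normc_ge0.
Qed.

Lemma zsum_normcE : E = \sum_(i < L.+1) normc (e (Posz i)) + \sum_(i < L.+1) normc (e (Negz i)).
Proof. by []. Qed.

Let Ep_ge0 : 0 <= \sum_(i < L.+1) normc (e (Posz i)).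
Proof. by apply: sumr_ge0 => i _; exact: normc_ge0. Qed.

Let En_ge0 : 0 <= \sum_(i < L.+1) normc (e (Negz i)).
Proof. by apply: sumr_ge0 => i _; exact: normc_ge0. Qed.

(** When [x ^+ 2 < 1] both characteristic roots have modulus one, so the same
quantity [v 0 - b v (-1)] is controlled from above and from below. This bounds
[a X + Y] for each of the two roots, and the roots are at distance at least
[2 k]. *)
Lemma rec_oscillating (k : R) : 0 < k -> x ^+ 2 + k ^+ 2 <= 1 ->
  normc X <= E / k /\ normc Y <= E + E / k.
Proof.
move=> k0 xk; pose s := Num.sqrt (1 - x ^+ 2).
have s2 : s ^+ 2 = 1 - x ^+ 2 by rewrite sqr_sqrtr // subr_ge0; nra.
have s0 : 0 <= s by exact: sqrtr_ge0.
have ks : k <= s by rewrite -(ler_pXn2r (n := 2)) ?nnegrE // ?(ltW k0) //; lra.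
pose a : C := x +i* s; pose b : C := x -i* s.
have ab1 : a * b = 1.
  by apply/eqP; rewrite eq_complex /=; apply/andP; split; apply/eqP; lra.
have abc : a + b = 2 * x%:C.
  by apply/eqP; rewrite eq_complex /=; apply/andP; split; apply/eqP; lra.
have na : normc a = 1 by rewrite /= (_ : x ^+ 2 + s ^+ 2 = 1) ?sqrtr1 //; lra.
have nb : normc b = 1 by rewrite /= (_ : x ^+ 2 + (- s) ^+ 2 = 1) ?sqrtr1 //; lra.
have main u w : u * w = 1 -> u + w = 2 * x%:C -> normc u = 1 -> normc w = 1 ->
    normc (u * X + Y) <= E.
  move=> uw1 uwc nu nw.
  have wu1 : w * u = 1 by rewrite mulrC.
  have wuc : w + u = 2 * x%:C by rewrite addrC.
  have := rec_from_above 0 wu1 wuc; rewrite nw lexx sub0r => /(_ isT) H1.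
  have := rec_from_below uw1 uwc; rewrite nu lexx => /(_ isT) H2.
  rewrite zsum_normcE (_ : u * X + Y = (v 0 - w * v (- 1)) - (v 0 - w * v (- 1) - (u * X + Y))); last by ring.
  by apply: (le_trans (ler_normcB _ _)); exact: lerD.
have Ha := main _ _ ab1 abc na nb.
have Hb := main b a (etrans (mulrC _ _) ab1) (etrans (addrC _ _) abc) nb na.
have HX : normc X <= E / k.
  have sX : 2 * s * normc X <= 2 * E.
    have -> : 2 * s * normc X = normc ((a * X + Y) - (b * X + Y)).
      rewrite (_ : a * X + Y - _ = (a - b) * X); last by ring.
      rewrite normcM; congr (_ * _).
      rewrite /= subrr expr0n add0r (_ : (s - - s) = 2 * s); last by ring.
      by rewrite sqrtr_sqr ger0_norm // mulr_ge0.
    by apply: (le_trans (ler_normcB _ _)); rewrite mulr_natl mulr2n; exact: lerD.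
  rewrite ler_pdivlMr //; have := normc_ge0 X; nra.
split => //.
rewrite (_ : Y = (a * X + Y) - a * X); last by ring.
apply: (le_trans (ler_normcB _ _)); apply: lerD => //.
by rewrite normcM na mul1r.
Qed.

(** One takes [a] to be a root of modulus at most one. Then [v (n+1) - a v n]
is bounded from above and [v (n+1) - b v n] from below, and their difference
is [(a - b) v n]. The factor [x ^+ 2 - 1] is [(a - b) ^+ 2 / 4]; it absorbs
the degeneration at a double root. *)
Lemma rec_bound (n : nat) :
  `|x ^+ 2 - 1| * normc (v n%:Z) <= (`|x| + 1) * (E + normc X + normc Y).
Proof.
(* The roots have product one, so one of them has modulus at most one. *)
have [a [b [ab1 abc a1]]] : exists a b : C, [/\ a * b = 1, a + b = 2 * x%:C & normc a <= 1].
  pose s : C := sqrtC (x%:C ^+ 2 - 1).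
  have s2 : s ^+ 2 = x%:C ^+ 2 - 1 by rewrite /s sqrtCK.
  have ab1 : (x%:C + s) * (x%:C - s) = 1 by rewrite mulrC -subr_sqr s2; ring.
  have := congr1 (@normc R) ab1; rewrite normcM normc1 => nn.
  have [a1|a1] := leP (normc (x%:C + s)) 1.
    by exists (x%:C + s), (x%:C - s); split=> //; ring.
  exists (x%:C - s), (x%:C + s); split; [by rewrite mulrC|by ring|].
  by have := normc_ge0 (x%:C - s); nra.
have Hp := rec_from_above n.+1 ab1 abc a1.
have Hq : normc (v n.+1%:Z - b * v (n.+1%:Z - 1)) <= E + normc X + normc Y.
  have H0 := rec_from_below ab1 abc a1.
  pose En := \sum_(i < L.+1) normc (e (Negz i)).
  have K m : normc (v m%:Z - b * v (m%:Z - 1)) <=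
      En + normc X + normc Y + \sum_(i < m) normc (e (Posz i)).
    elim: m => [|m IH].
      rewrite big_ord0 addr0 sub0r -addrA.
      rewrite -(subrK (a * X + Y) (_ - _ * _)) (le_trans (ler_normcD _ _)) // lerD //.
      rewrite (le_trans (ler_normcD _ _)) // lerD2r normcM ler_piMl ?normc_ge0 //.
    have -> : v m.+1%:Z - b * v (m.+1%:Z - 1) = a * (v m%:Z - b * v (m%:Z - 1)) + e m%:Z.
      have := veq m%:Z; rewrite (g0 (n := m%:Z)) // addr0 -abc => <-.
      rewrite mulrBr mulrA ab1 (_ : m.+1%:Z - 1 = m%:Z); last by lia.
      by rewrite (_ : m%:Z + 1 = m.+1%:Z); [ring|lia].
    rewrite big_ord_recr /= addrA (le_trans (ler_normcD _ _)) // lerD2r.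
    by rewrite (le_trans _ IH) // normcM ler_piMl // normc_ge0.
  have [nL|nL] := leqP n.+1 L.+1; last first.
    rewrite !v0 ?mulr0 ?subrr ?normc0; try lia.
    by rewrite !addr_ge0 // ?normc_ge0.
  apply: (le_trans (K _)); rewrite zsum_normcE -/En.
  have : \sum_(i < n.+1) normc (e (Posz i)) <= \sum_(i < L.+1) normc (e (Posz i)).
    rewrite -!(big_mkord xpredT (fun i => normc (e (Posz i)))) [leRHS](big_cat_nat _ nL) //= lerDl.
    by apply: sumr_ge0 => i _; exact: normc_ge0.
  lra.
rewrite (_ : n.+1%:Z - 1 = n) in Hp Hq; last by lia.
have ab4 : normc (a - b) * normc (a - b) = 4 * `|x ^+ 2 - 1|.
  rewrite -normcM (_ : (a - b) * (a - b) = (4 * (x ^+ 2 - 1))%:C).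
    by rewrite normc_real normrM ger0_norm.
  rewrite (_ : (a - b) * (a - b) = (a + b) * (a + b) - 4 * (a * b)); last by ring.
  by rewrite abc ab1 !rmorphM !rmorphB /= rmorphXn !rmorph_nat rmorph1; ring.
have abx : normc (a - b) <= 2 * (`|x| + 1).
  rewrite -(ler_pXn2r (n := 2)) ?nnegrE ?normc_ge0 ?mulr_ge0 ?addr_ge0 // expr2 ab4.
  have := ler_normB (x ^+ 2) 1; rewrite normr1 normrX.
  have := normr_ge0 x; nra.
have abv : normc (a - b) * normc (v n%:Z) <= 2 * (E + normc X + normc Y).
  rewrite -normcM (_ : (a - b) * v n%:Z =
    (v n.+1%:Z - b * v n%:Z) - (v n.+1%:Z - a * v n%:Z)); last by ring.
  apply: (le_trans (ler_normcB _ _)).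
  have := zsum_normcE; have := normc_ge0 X; have := normc_ge0 Y; have := En_ge0; lra.
have -> : `|x ^+ 2 - 1| * normc (v n%:Z) = normc (a - b) * (normc (a - b) * normc (v n%:Z)) / 4.
  by rewrite mulrA ab4; field.
rewrite ler_pdivrMr //.
have := ler_pM (normc_ge0 _) (mulr_ge0 (normc_ge0 _) (normc_ge0 _)) abx abv.
by rewrite (_ : 2 * (`|x| + 1) * _ = (`|x| + 1) * (E + normc X + normc Y) * 4) //; ring.
Qed.

End Recurrence.

(** * Exponential sums on a line *)

Section ExponentialSums.
Variable R : realType.
Local Notation C := R[i].
Implicit Types (M B t : R) (H K : R -> C).

(** The weight [expR (2 b)] is what the continuation from [0] to [1] consumes.
The representation as a sum of exponentials is not unique, and [M] only has to
bound one of them; this makes the bound stable under sums and products. *)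
Definition expsum M H := exists s : seq (C * R),
  (forall t, H t = \sum_(p <- s) p.1 * cis (t * p.2)) /\
  \sum_(p <- s) normc p.1 * expR (2 * `|p.2|) <= M.

Lemma expsum_le M M' H : M <= M' -> expsum M H -> expsum M' H.
Proof. by move=> MM' [s [Hs sM]]; exists s; split=> //; exact: le_trans MM'. Qed.

Lemma eq_expsum M H K : H =1 K -> expsum M H -> expsum M K.
Proof. by move=> HK [s [Hs sM]]; exists s; split=> // t; rewrite -HK. Qed.

Lemma expsum_cis (a : C) (b : R) :
  expsum (normc a * expR (2 * `|b|)) (fun t => a * cis (t * b)).
Proof. by exists [:: (a, b)]; split=> [t|]; rewrite big_seq1. Qed.

Lemma expsum_const (a : C) : expsum (normc a) (fun=> a).
Proof.
have := expsum_cis a 0; rewrite normr0 mulr0 expR0 mulr1; apply: eq_expsum => t.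
by rewrite mulr0 cis0 mulr1.
Qed.

Lemma expsumD M M' H K : expsum M H -> expsum M' K ->
  expsum (M + M') (fun t => H t + K t).
Proof.
move=> [s [Hs sM]] [s' [Hs' sM']]; exists (s ++ s'); split=> [t|].
  by rewrite big_cat /= Hs Hs'.
by rewrite big_cat /= lerD.
Qed.

Lemma expsumM M M' H K : expsum M H -> expsum M' K ->
  expsum (M * M') (fun t => H t * K t).
Proof.
move=> [s [Hs sM]] [s' [Hs' sM']].
exists [seq (p.1 * q.1, p.2 + q.2) | p <- s, q <- s']; split=> [t|].
  rewrite Hs Hs' big_allpairs_dep mulr_suml; apply: eq_bigr => p _.
  rewrite mulr_sumr; apply: eq_bigr => q _.
  by rewrite mulrDr cisD /=; ring.
rewrite big_allpairs_dep; apply: (@le_trans _ _ (\sum_(p <- s) \sum_(q <- s')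
    (normc p.1 * expR (2 * `|p.2|)) * (normc q.1 * expR (2 * `|q.2|)))).
  apply: ler_sum => p _; apply: ler_sum => q _ /=.
  rewrite normcM mulrACA ler_wpM2l ?mulr_ge0 ?normc_ge0 // -expRD ler_expR.
  by rewrite -mulrDr ler_pM2l // ler_normD.
under eq_bigr do rewrite -mulr_sumr.
rewrite -mulr_suml; apply: ler_pM => //; apply: sumr_ge0 => p _;
  by rewrite mulr_ge0 ?normc_ge0 ?expR_ge0.
Qed.

Lemma expsum_sum (I : Type) (r : seq I) (F : I -> R -> C) (M : I -> R) :
  (forall i, expsum (M i) (F i)) ->
  expsum (\sum_(i <- r) M i) (fun t => \sum_(i <- r) F i t).
Proof.
move=> HF; elim: r => [|i r IH].
  rewrite big_nil -normc0; apply: eq_expsum (expsum_const 0) => t.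
  by rewrite big_nil.
rewrite big_cons; apply: eq_expsum (expsumD (HF i) IH) => t.
by rewrite big_cons.
Qed.

Lemma expsum_cheb (x0 x1 : C) B D (c : R -> C) n :
  normc x0 <= 1 -> normc x1 <= 1 -> expsum B c -> 0 <= B -> 2 * B + 1 <= D ->
  expsum (D ^+ n) (fun t => cheb x0 x1 (c t) n).
Proof.
move=> nx0 nx1 cB B0 BD; have D1 : 1 <= D by lra.
suff [] : expsum (D ^+ n) (fun t => cheb x0 x1 (c t) n) /\
   expsum (D ^+ n.+1) (fun t => cheb x0 x1 (c t) n.+1) by [].
elim: n => [|n [IH1 IH2]].
  split; first by apply: expsum_le (expsum_const x0); rewrite expr0.
  by apply: expsum_le (expsum_const x1); rewrite expr1 (le_trans nx1).
split=> //.
have H := expsumD (expsumM (expsumM (expsum_const 2) cB) IH2)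
  (expsumM (expsum_const (- 1)) IH1).
apply: expsum_le (eq_expsum _ H) => [|t]; last by rewrite chebS2; ring.
rewrite normcNE normc1 normc_nat mul1r !exprS.
have Dn : 0 <= D ^+ n by rewrite exprn_ge0 //; lra.
have : D * D ^+ n * (2 * B + 1) <= D * D ^+ n * D by rewrite ler_wpM2l // mulr_ge0 //; lra.
have : 1 * D ^+ n <= D * D ^+ n by rewrite ler_wpM2r.
lra.
Qed.

Lemma expsum_lip M H t t' : expsum M H -> normc (H t - H t') <= M * `|t - t'|.
Proof.
move=> [s [Hs sM]]; rewrite !Hs -sumrB (le_trans (ler_normc_sum _ _ _)) //.
rewrite (le_trans _ (ler_wpM2r _ sM)) // mulr_suml; apply: ler_sum => p _.
rewrite -mulrBr normcM -mulrA ler_wpM2l ?normc_ge0 //.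
rewrite (le_trans (normc_cisB _ _)) // -mulrBl normrM mulrC ler_wpM2r //.
have := expR_ge1Dx (2 * `|p.2|); have := normr_ge0 p.2; lra.
Qed.

(** A quantitative identity theorem: if [H] is small near [0] then it is small
at [1]. Expand [cis b = (1 + (cis (b / N) - 1)) ^+ N] by the binomial formula.
The [j]-th term is a [j]-th finite difference of [H] at [0] with step [1 / N];
for [j < J] it only sees values of [H] assumed small, and for [j >= J] it is
bounded by [(b / N) ^ j], which gains [2 ^- J] against the weight [expR (2 b)]
in the norm. *)
Lemma expsum_continuation M H (N J : nat) (eta : R) :
  expsum M H -> (0 < N)%N -> 
  (forall l, (l < J)%N -> normc (H (l%:R / N%:R)) <= eta) -> 0 <= eta ->
  normc (H 1) <= 3 ^+ N * eta + M / 2 ^+ J.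
Proof.
move=> [s [Hs sM]] N0 Heta eta0.
have N0R : (0 : R) < N%:R by rewrite ltr0n.
pose w (p : C * R) := cis (p.2 / N%:R).
pose D j := \sum_(p <- s) p.1 * (w p - 1) ^+ j.
have HD : H 1 = \sum_(j < N.+1) D j *+ 'C(N, j).
  rewrite Hs (eq_bigr (fun p : C * R => \sum_(j < N.+1) (p.1 * (w p - 1) ^+ j) *+ 'C(N, j))).
    by rewrite exchange_big /=; apply: eq_bigr => j _; rewrite sumrMnl.
  move=> p _; rewrite mul1r.
  have -> : cis p.2 = (1 + (w p - 1)) ^+ N.
    by rewrite addrC subrK -cisMn mulrCA mulfV ?mulr1 // gt_eqF.
  rewrite exprDn mulr_sumr; apply: eq_bigr => j _.
  by rewrite expr1n mul1r mulrnAr.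
have Dsmall j : (j < J)%N -> normc (D j) <= 2 ^+ j * eta.
  move=> jJ; have -> : D j = \sum_(l < j.+1) (-1) ^+ l * H ((j - l)%N%:R / N%:R) *+ 'C(j, l).
    rewrite /D (eq_bigr (fun p : C * R => \sum_(l < j.+1)
        ((-1) ^+ l * (p.1 * cis ((j - l)%N%:R / N%:R * p.2))) *+ 'C(j, l))).
      rewrite exchange_big /=; apply: eq_bigr => l _.
      by rewrite sumrMnl Hs mulr_sumr.
    move=> p _; rewrite exprBn mulr_sumr; apply: eq_bigr => l _.
    rewrite expr1n mulr1 mulrnAr mulrCA /w -cisMn; congr (_ * (_ * cis _) *+ _).
    by rewrite mulrA mulrAC.
  apply: (le_trans (ler_normc_sum _ _ _)).
  have -> : (2 : R) ^+ j = \sum_(l < j.+1) ('C(j, l))%:R.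
    by rewrite -natrX -(addn1 1) expnDn natr_sum; apply: eq_bigr => l _;
      rewrite !exp1n !muln1.
  rewrite mulr_suml; apply: ler_sum => l _.
  rewrite -mulr_natl !normcM normc_nat normcX normcNE normc1 expr1n mul1r.
  by rewrite ler_wpM2l ?ler0n //; apply: Heta; rewrite (leq_ltn_trans _ jJ) // leq_subr.
have Dle j : normc (D j) <= \sum_(p <- s) normc p.1 * (`|p.2| / N%:R) ^+ j.
  apply: (le_trans (ler_normc_sum _ _ _)); apply: ler_sum => p _.
  rewrite normcM ler_wpM2l ?normc_ge0 // normcX lerXn2r ?nnegrE ?normc_ge0 ?divr_ge0 //.
  by rewrite (le_trans (normc_cisB1 _)) // normrM normfV [`|N%:R|]ger0_norm // ltW.
have DleJ j : normc (D j) <= 2 ^+ j * eta +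
    (\sum_(p <- s) normc p.1 * (2 * `|p.2| / N%:R) ^+ j) / 2 ^+ J.
  have S0 : 0 <= \sum_(p <- s) normc p.1 * (2 * `|p.2| / N%:R) ^+ j.
    by apply: sumr_ge0 => p _; rewrite mulr_ge0 ?normc_ge0 // exprn_ge0 // divr_ge0 ?mulr_ge0.
  have [jJ|Jj] := ltnP j J.
    by rewrite (le_trans (Dsmall _ jJ)) // lerDl divr_ge0 // exprn_ge0.
  rewrite (le_trans (Dle j)) // (le_trans _ (ler_wpDl _ (lexx _))) ?mulr_ge0 ?exprn_ge0 //.
  rewrite mulr_suml; apply: ler_sum => p _.
  rewrite -mulrA ler_wpM2l ?normc_ge0 // -mulrA [X in _ <= X / _]exprMn mulrAC.
  rewrite ler_peMl ?exprn_ge0 ?divr_ge0 //.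
  by rewrite ler_pdivlMr ?exprn_gt0 // mul1r ler_weXn2l // ler1n.
rewrite HD (le_trans (ler_normc_sum _ _ _)) //.
apply: (@le_trans _ _ (\sum_(j < N.+1) (2 ^+ j * eta +
  (\sum_(p <- s) normc p.1 * (2 * `|p.2| / N%:R) ^+ j) / 2 ^+ J) *+ 'C(N, j))).
  by apply: ler_sum => j _; rewrite -[D j *+ _]mulr_natl normcM normc_nat mulr_natl lerMn2r DleJ orbT.
under eq_bigr do rewrite mulrnDl; rewrite big_split /=; apply: lerD.
  have -> : (3 : R) ^+ N = \sum_(j < N.+1) 2 ^+ j *+ 'C(N, j).
    rewrite [3](_ : _ = 1 + 2); last by ring.
    by rewrite exprDn; apply: eq_bigr => j _; rewrite expr1n mul1r.
  by rewrite mulr_suml; apply: ler_sum => j _; rewrite mulrnAl.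
under eq_bigr do rewrite -mulrnAl -sumrMnl.
rewrite -mulr_suml ler_wpM2r ?invr_ge0 ?exprn_ge0 //.
rewrite exchange_big /= (le_trans _ sM) //; apply: ler_sum => p _.
under eq_bigr do rewrite -mulrnAr; rewrite -mulr_sumr ler_wpM2l ?normc_ge0 //.
have -> : \sum_(j < N.+1) (2 * `|p.2| / N%:R) ^+ j *+ 'C(N, j) = (1 + 2 * `|p.2| / N%:R) ^+ N.
  by rewrite exprDn; apply: eq_bigr => j _; rewrite expr1n mul1r.
apply: (@le_trans _ _ (expR (2 * `|p.2| / N%:R) ^+ N)).
  by rewrite lerXn2r ?nnegrE ?expR_ge0 ?expR_ge1Dx //.
by rewrite -expRM_natl mulrC divfK // gt_eqF.
Qed.

End ExponentialSums.

(** * Finitely supported functions on the lattice and their Fourier sums *)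

Lemma sum_half_powers (R : realType) n :
  \sum_(b < n) (2^-1 : R) ^+ b = 2 - 2 * 2^-1 ^+ n.
Proof.
elim: n => [|n IH]; first by rewrite big_ord0 expr0 mulr1 subrr.
by rewrite big_ord_recr /= IH exprS; field.
Qed.

Section LatticeSums.
Variables (R : realType) (k : nat).
Local Notation C := R[i].
Local Notation T := 'rV[int]_k.
Implicit Types x y : T.

Definition supnorm x : nat := \max_(j < k) `|x ord0 j|%N.

Definition evec (j : 'I_k) : T := delta_mx ord0 j.

Lemma le_supnorm x j : (`|x ord0 j| <= supnorm x)%N.
Proof. exact: (@leq_bigmax _ (fun j => `|x ord0 j|%N) j). Qed.

Lemma supnormD x y : (supnorm (x + y) <= supnorm x + supnorm y)%N.
Proof.
apply/bigmax_leqP => j _; rewrite mxE.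
apply: (@leq_trans (`|x ord0 j| + `|y ord0 j|)); last by rewrite leq_add // le_supnorm.
by move: (x _ _) (y _ _) => a b; lia.
Qed.

Lemma supnormN x : supnorm (- x) = supnorm x.
Proof. by apply: eq_bigr => j _; rewrite mxE abszN. Qed.

Lemma supnorm_evec j : (supnorm (evec j) <= 1)%N.
Proof. by apply/bigmax_leqP => i _; rewrite mxE eqxx; case: eqP. Qed.

Definition supported (V : nmodType) (L : nat) (g : T -> V) :=
  forall x, (L <= supnorm x)%N -> g x = 0.

(** Equal to zero by convention when the support is infinite; hence the
support conditions in the additivity lemmas, and their absence where a
bijection or a scalar is involved. *)
Definition lsum (V : nmodType) (g : T -> V) : V := \sum_(x \in [set: T]) g x.

(** One layer more on the negative side than the support condition of radius
[L] needs: the side is then [L + L], as for [zsum]. *)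
Definition boxpt (L : nat) (i : {ffun 'I_k -> 'I_(L + L)}) : T :=
  \row_j ((i j)%:Z - L%:Z).

Lemma boxpt_inj L : injective (@boxpt L).
Proof.
move=> i i' /rowP E; apply/ffunP => j; apply/val_inj.
by have := E j; rewrite !mxE => /addIr [].
Qed.

Lemma boxpt_surj L x : (supnorm x < L)%N -> exists i, x = @boxpt L i.
Proof.
move=> xL.
have xj j : (`|x ord0 j| < L)%N.
  by apply: leq_ltn_trans xL; exact: le_supnorm.
have kP j : (absz (x ord0 j + L%:Z)%R < L + L)%N by have := xj j; lia.
exists [ffun j => Ordinal (kP j)]; apply/rowP => j; rewrite mxE ffunE /=.
by move: (x ord0 j) (xj j) => n; lia.
Qed.

Lemma lsumE (V : nmodType) L (g : T -> V) : supported L g ->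
  lsum g = \sum_(i : {ffun 'I_k -> 'I_(L + L)}) g (boxpt i).
Proof.
move=> gL; rewrite /lsum (fsbigE [seq boxpt i | i <- index_enum {ffun 'I_k -> 'I_(L + L)}]) //.
- by rewrite big_map; apply: eq_bigl => i; rewrite in_setT.
- by rewrite map_inj_uniq; [exact: index_enum_uniq|exact: boxpt_inj].
move=> x _ xL; apply: gL; rewrite leqNgt; apply: contra xL => /boxpt_surj[i ->].
by apply: map_f; exact: mem_index_enum.
Qed.

Lemma lsum_shift (V : nmodType) (g : T -> V) y : lsum (fun x => g (x + y)) = lsum g.
Proof.
rewrite /lsum [RHS](reindex_fsbigT (fun x : T => x + y)) //.
by exists (fun x => x - y) => x; rewrite ?addrK ?subrK.
Qed.

Lemma supported_le (V : nmodType) L L' (g : T -> V) :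
  (L <= L')%N -> supported L g -> supported L' g.
Proof. by move=> LL gL x Lx; apply: gL; exact: leq_trans Lx. Qed.

Lemma supported_shift (V : nmodType) L (g : T -> V) y : (supnorm y <= 1)%N ->
  supported L g -> supported L.+1 (fun x => g (x + y)).
Proof.
move=> y1 gL x Lx; apply: gL; have := supnormD (x + y) (- y).
by rewrite addrK supnormN; lia.
Qed.

Lemma lsumD (V : nmodType) L (g h : T -> V) : supported L g -> supported L h ->
  lsum (fun x => g x + h x) = lsum g + lsum h.
Proof.
move=> gL hL; rewrite (lsumE gL) (lsumE hL) -big_split /= (@lsumE _ L) //.
by move=> x Lx; rewrite gL // hL // addr0.
Qed.

Lemma lsum_sum (V : nmodType) L (I : Type) (r : seq I) (g : I -> T -> V) :
  (forall i, supported L (g i)) ->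
  lsum (fun x => \sum_(i <- r) g i x) = \sum_(i <- r) lsum (g i).
Proof.
move=> gL; rewrite (@lsumE _ L); last by move=> x Lx; rewrite big1 // => i _; exact: gL.
by rewrite exchange_big /=; apply: eq_bigr => i _; rewrite (lsumE (gL i)).
Qed.

Lemma lsumZ (V : idomainType) (a : V) (g : T -> V) :
  lsum (fun x => a * g x) = a * lsum g.
Proof. by rewrite /lsum mulr_fsumr. Qed.

Lemma eq_lsum (V : nmodType) (g h : T -> V) : g =1 h -> lsum g = lsum h.
Proof. by move=> /funext ->. Qed.

Lemma ler_lsum L (g h : T -> R) : supported L g -> supported L h ->
  (forall x, g x <= h x) -> lsum g <= lsum h.
Proof. by move=> gL hL gh; rewrite (lsumE gL) (lsumE hL); apply: ler_sum. Qed.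

Lemma lsum_ge0 (g : T -> R) : (forall x, 0 <= g x) -> 0 <= lsum g.
Proof. by move=> g0; apply: sumr_ge0 => x _. Qed.

Lemma ler_lsum_pt L (g : T -> R) x : supported L g -> (forall y, 0 <= g y) ->
  g x <= lsum g.
Proof.
move=> gL g0; have [/boxpt_surj[i ->]|Lx] := ltnP (supnorm x) L.
  by rewrite (lsumE gL) (bigD1 i) //= lerDl sumr_ge0.
by rewrite (gL _ Lx); exact: lsum_ge0.
Qed.

Definition onenorm x : nat := \sum_(j < k) `|x ord0 j|%N.

(** The sum of [2 ^- |n|] over all integers is [3]; the point is that the
bound does not depend on [L]. *)
Lemma lsum_geometric L :
  lsum (fun x => if (supnorm x < L)%N then (2^-1 : R) ^+ onenorm x else 0) <= 3 ^+ k.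
Proof.
rewrite (@lsumE _ L); last by move=> x; rewrite leqNgt => /negbTE ->.
apply: (@le_trans _ _ (\sum_(i : {ffun 'I_k -> 'I_(L + L)})
    \prod_(j < k) (2^-1 : R) ^+ `|(i j)%:Z - L%:Z|)).
  apply: ler_sum => i _; case: ifP => _; last first.
    by apply: prodr_ge0 => j _; rewrite exprn_ge0 ?invr_ge0.
  rewrite -expr_sum /onenorm (eq_bigr (fun j => `|(i j)%:Z - L%:Z|%N)) // => j _.
  by rewrite mxE.
rewrite -(bigA_distr_bigA (fun (j : 'I_k) (b : 'I_(L + L)) => (2^-1 : R) ^+ `|b%:Z - L%:Z|)) /=.
rewrite -[X in _ <= 3 ^+ X](card_ord k) -prodr_const; apply: ler_prod => j _.
apply/andP; split; first by apply: sumr_ge0 => b _; rewrite exprn_ge0 ?invr_ge0.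
rewrite big_split_ord /=.
have -> : \sum_(i < L) (2^-1 : R) ^+ `|(L + i)%N%:Z - L%:Z| = \sum_(b < L) (2^-1 : R) ^+ b.
  by apply: eq_bigr => b _; congr (_ ^+ _); lia.
have -> : \sum_(i < L) (2^-1 : R) ^+ `|i%:Z - L%:Z| = \sum_(b < L) 2^-1 * (2^-1 : R) ^+ b.
  rewrite (reindex_inj rev_ord_inj) /=; apply: eq_bigr => b _.
  by rewrite -exprS; congr (_ ^+ _); have := ltn_ord b; lia.
rewrite -mulr_sumr sum_half_powers.
have : 0 <= (2^-1 : R) ^+ L by rewrite exprn_ge0 ?invr_ge0.
lra.
Qed.

Definition chi (xi : 'I_k -> R) x : C := cis (\sum_(j < k) (x ord0 j)%:~R * xi j).

Lemma chiD xi x y : chi xi (x + y) = chi xi x * chi xi y.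
Proof.
rewrite /chi -cisD -big_split /=; congr cis; apply: eq_bigr => j _.
by rewrite mxE rmorphD mulrDl.
Qed.

Lemma chiN xi x : chi xi (- x) = (chi xi x)^*.
Proof.
rewrite /chi -cisN -sumrN; congr cis; apply: eq_bigr => j _.
by rewrite mxE rmorphN mulNr.
Qed.

Lemma normc_chi xi x : normc (chi xi x) = 1.
Proof. exact: normc_cis. Qed.

Lemma chi_evec xi j : chi xi (evec j) = cis (xi j).
Proof.
rewrite /chi (bigD1 j) //= mxE !eqxx mul1r big1 ?addr0 // => i ij.
by rewrite mxE eqxx (negbTE ij) mul0r.
Qed.

Definition ft (g : T -> C) (xi : 'I_k -> R) : C := lsum (fun x => g x * chi xi x).

Lemma supportedMr (V : pzSemiRingType) L (g h : T -> V) :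
  supported L g -> supported L (fun x => g x * h x).
Proof. by move=> gL x Lx; rewrite gL // mul0r. Qed.

Lemma ftD L (g h : T -> C) xi : supported L g -> supported L h ->
  ft (fun x => g x + h x) xi = ft g xi + ft h xi.
Proof.
move=> gL hL; rewrite -(@lsumD _ L); try exact: supportedMr.
by apply: eq_lsum => x; rewrite mulrDl.
Qed.

Lemma ftZ a (g : T -> C) xi : ft (fun x => a * g x) xi = a * ft g xi.
Proof. by rewrite -lsumZ; apply: eq_lsum => x; rewrite mulrA. Qed.

Lemma ft_sum L (I : Type) (r : seq I) (g : I -> T -> C) xi :
  (forall i, supported L (g i)) ->
  ft (fun x => \sum_(i <- r) g i x) xi = \sum_(i <- r) ft (g i) xi.
Proof.
move=> gL; rewrite -(@lsum_sum _ L); last by move=> i; exact: supportedMr.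
by apply: eq_lsum => x; rewrite mulr_suml.
Qed.

Lemma ft_shift (g : T -> C) y xi : ft (fun x => g (x + y)) xi = chi xi (- y) * ft g xi.
Proof.
rewrite -lsumZ -[RHS](lsum_shift _ y); apply: eq_lsum => x.
have yy : (chi xi y)^* * chi xi y = 1.
  by rewrite mulrC normc_mul_conj normc_chi expr1n.
rewrite /= chiD chiN -[LHS]mulr1 -yy; ring.
Qed.

(** Half the sum of the two adjacent slices, as prescribed by the homogeneous
equation when [mu] is [2 d - lambda]; [symbol] below is its Fourier
multiplier. *)
Definition hop (mu : R) (g : T -> C) x : C :=
  (mu / 2)%:C * g x - 2^-1 * \sum_(j < k) (g (x + evec j) + g (x - evec j)).

Definition symbol (mu : R) (xi : 'I_k -> R) : R := mu / 2 - \sum_(j < k) cos (xi j).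

Lemma supported_hop mu L (g : T -> C) : supported L g -> supported L.+1 (hop mu g).
Proof.
move=> gL x Lx; rewrite /hop (gL x) ?(ltnW Lx) // mulr0 sub0r big1 ?mulr0 ?oppr0 // => j _.
rewrite (supported_shift (supnorm_evec j) gL) //.
by rewrite (supported_shift _ gL) ?addr0 // supnormN supnorm_evec.
Qed.

Lemma ft_hop mu L (g : T -> C) xi : supported L g ->
  ft (hop mu g) xi = (symbol mu xi)%:C * ft g xi.
Proof.
move=> gL.
have gLs y : (supnorm y <= 1)%N -> supported L.+1 (fun x => g (x + y)).
  by move=> y1; exact: supported_shift.
have gp j := gLs _ (supnorm_evec j).
have gm j : supported L.+1 (fun x => g (x - evec j)).
  by apply: gLs; rewrite supnormN supnorm_evec.
have gpm j : supported L.+1 (fun x => g (x + evec j) + g (x - evec j)).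
  by move=> x Lx; rewrite (gp j x Lx) (gm j x Lx) addr0.
rewrite /hop (_ : (fun x => _) = (fun x => (mu / 2)%:C * g x +
  (- 2^-1) * \sum_(j < k) (g (x + evec j) + g (x - evec j)))); last first.
  by apply/funext => x; rewrite mulNr.
rewrite (@ftD L.+1); first 1 last.
- by move=> x Lx; rewrite (gL _ (ltnW Lx)) mulr0.
- by move=> x Lx; rewrite big1 ?mulr0 // => j _; rewrite gpm.
rewrite !ftZ (ft_sum _ _ gpm) rmorphB mulrBl mulNr rmorph_sum; congr (_ - _).
rewrite mulr_sumr mulr_suml; apply: eq_bigr => j _.
rewrite (ftD xi (gp j) (gm j)) !ft_shift opprK chiN chi_evec -cisN -mulrDl.
by rewrite [cis (- _) + _]addrC cisDcisN rmorphM /= rmorph_nat mulrA mulrA mulVf ?mul1r //.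
Qed.

Definition gridpt (K : nat) (xi : 'I_k -> R) (a : {ffun 'I_k -> 'I_K}) : 'I_k -> R :=
  fun j => xi j + 2 * pi * (a j)%:R / K%:R.

Lemma sum_chi_grid K xi x : (supnorm x < K)%N ->
  \sum_(a : {ffun 'I_k -> 'I_K}) chi (gridpt xi a) x = if x == 0 then (K ^ k)%:R else 0.
Proof.
move=> xK.
have E (a : {ffun 'I_k -> 'I_K}) : chi (gridpt xi a) x =
    chi xi x * \prod_(j < k) cis ((x ord0 j)%:~R * (2 * pi * (a j)%:R / K%:R)).
  rewrite /chi /gridpt; under eq_bigr do rewrite mulrDr.
  rewrite big_split cisD; congr (_ * _).
  exact: (big_morph (@cis R) (@cisD R) (@cis0 R)).
under eq_bigr do rewrite E.
rewrite -mulr_sumr -(bigA_distr_bigA (fun (j : 'I_k) (b : 'I_K) =>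
   cis ((x ord0 j)%:~R * (2 * pi * b%:R / K%:R)))) /=.
have xj j : (`|x ord0 j| < K)%N.
  by apply: leq_ltn_trans xK; exact: le_supnorm.
under eq_bigr do rewrite sum_cis_roots //.
case: eqP => [->|/eqP xn0].
  rewrite (eq_bigr (fun=> K%:R)); last by move=> j _; rewrite mxE eqxx.
  rewrite prodr_const card_ord natrX /chi big1 ?cis0 ?mul1r // => j _.
  by rewrite mxE mul0r.
have [j xjn0] : exists j, x ord0 j != 0.
  apply/existsP; rewrite -[[exists _, _]]negbK negb_exists; apply: contra xn0 => /forallP H.
  by apply/eqP/rowP => j; rewrite mxE; have := H j; rewrite negbK => /eqP.
by rewrite (bigD1 j) //= (negbTE xjn0) mul0r mulr0.
Qed.

(** The grid is a translate of the character group of the [k]-th power of the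
cyclic group of order [K]; since the support of [g] has diameter less than
[K], two distinct points of it are separated by these characters. *)
Lemma parseval K L xi (g : T -> C) : supported L g -> (L + L < K)%N ->
  \sum_(a : {ffun 'I_k -> 'I_K}) normc (ft g (gridpt xi a)) ^+ 2
  = (K ^ k)%:R * lsum (fun x => normc (g x) ^+ 2).
Proof.
move=> gL LK.
apply: (fmorph_inj (@real_complex R)); rewrite rmorph_sum rmorphM /= rmorph_nat.
rewrite (@lsumE _ L); last by move=> x Lx; rewrite gL // normc0 expr0n.
rewrite rmorph_sum mulr_sumr /=.
have E a : (normc (ft g (gridpt xi a)) ^+ 2)%:C = \sum_(i : {ffun 'I_k -> 'I_(L + L)})
    \sum_(i' : {ffun 'I_k -> 'I_(L + L)}) g (boxpt i) * (g (boxpt i'))^* *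
      chi (@gridpt K xi a) (boxpt i - boxpt i').
  rewrite -normc_mul_conj /ft (@lsumE _ L); last exact: supportedMr.
  rewrite rmorph_sum mulr_suml; apply: eq_bigr => i _.
  rewrite mulr_sumr; apply: eq_bigr => i' _.
  by rewrite chiD chiN rmorphM mulrACA.
under eq_bigr do rewrite E.
rewrite exchange_big /=; apply: eq_bigr => i _.
rewrite exchange_big /= (bigD1 i) //= [X in _ + X]big1 ?addr0.
  rewrite -mulr_sumr sum_chi_grid subrr ?eqxx ?normc_mul_conj 1?mulrC //.
  by rewrite /supnorm big1 ?(leq_ltn_trans _ LK) // => j _; rewrite mxE.
move=> i' ii'; rewrite -mulr_sumr sum_chi_grid ?subr_eq0.
  case: eqP => [/boxpt_inj E'|_]; last by rewrite mulr0.
  by rewrite E' eqxx in ii'.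
rewrite (leq_ltn_trans _ LK) //; apply/bigmax_leqP => j _; rewrite !mxE.
have := ltn_ord (i j); have := ltn_ord (i' j); lia.
Qed.

End LatticeSums.

(** * Sums over an interval and the cutoff *)

Section Cutoff.
Variables (R : realType) (k : nat).
Local Notation C := R[i].
Local Notation T := 'rV[int]_k.
Implicit Types (x y : T) (n : int).

Lemma sqr_sum_le (I : Type) (s : seq I) (a : I -> R) :
  (\sum_(i <- s) a i) ^+ 2 <= (size s)%:R * \sum_(i <- s) a i ^+ 2.
Proof.
elim: s => [|i s IH]; first by rewrite !big_nil expr0n mul0r.
rewrite !big_cons /= -natr1.
set S := \sum_(_ <- s) _ in IH *; set Q := \sum_(_ <- s) _ in IH *.
have [s0|s0] := posnP (size s).
  move: IH; rewrite /S /Q (size0nil s0) !big_nil /=; nra.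
have n0 : (0 : R) < (size s)%:R by rewrite ltr0n.
rewrite -(ler_pM2l n0) -subr_ge0.
rewrite (_ : _ - _ = ((size s)%:R * a i - S) ^+ 2 + ((size s)%:R * Q - S ^+ 2) * (1 + (size s)%:R)); last by ring.
by rewrite addr_ge0 ?sqr_ge0 // mulr_ge0 ?subr_ge0 // addr_ge0.
Qed.

Lemma ler_zsum L (g h : int -> R) : (forall n, g n <= h n) -> zsum L g <= zsum L h.
Proof. by move=> gh; rewrite /zsum lerD //; apply: ler_sum. Qed.

Lemma zsum_ge0 L (g : int -> R) : (forall n, 0 <= g n) -> 0 <= zsum L g.
Proof. by move=> g0; rewrite /zsum addr_ge0 //; apply: sumr_ge0. Qed.

Lemma zsum_sum L (I : Type) (r : seq I) (g : I -> int -> R) :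
  zsum L (fun n => \sum_(i <- r) g i n) = \sum_(i <- r) zsum L (g i).
Proof.
rewrite /zsum exchange_big [X in _ + X]exchange_big -big_split /=.
by apply: eq_bigr.
Qed.

Lemma zsumZ L a (g : int -> R) : zsum L (fun n => a * g n) = a * zsum L g.
Proof. by rewrite /zsum mulrDr !mulr_sumr. Qed.

Lemma zsum_sqr L (g : int -> R) :
  zsum L g ^+ 2 <= (L + L)%:R * zsum L (fun n => g n ^+ 2).
Proof.
have H (h : 'I_L -> R) := sqr_sum_le (index_enum 'I_L) h.
have sL : size (index_enum 'I_L) = L.
  by rewrite -[RHS](size_enum_ord L) enumT.
have := H (fun i => g (Posz i)); have := H (fun i => g (Negz i)).
rewrite sL /zsum natrD.
set a := \sum_(i <- _) _; set b := \sum_(i <- _) _; set c := \sum_(i <- _) _.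
set d := \sum_(i <- _) _.
have : (c + a) ^+ 2 <= 2 * c ^+ 2 + 2 * a ^+ 2 by have := sqr_ge0 (a - c); lra.
lra.
Qed.

Lemma zsum_shift L (g : int -> R) a : (forall n, 0 <= g n) -> (`|a| <= 1)%N ->
  zsum L (fun n => g (n + a)) <= zsum L.+1 g.
Proof.
move=> g0 a1.
have [->|[->|->]] : a = 0 \/ a = 1 \/ a = - 1 by lia.
- rewrite /zsum !big_ord_recr /=.
  under eq_bigr do rewrite addr0; under [X in _ + X <= _]eq_bigr do rewrite addr0.
  by rewrite lerD // lerDl.
- rewrite /zsum big_ord_recl big_ord_recr /=.
  rewrite (eq_bigr (fun i : 'I_L => g (Posz (bump 0 i)))); last first.
    by move=> i _; congr g; rewrite /bump; lia.
  case: L => [|L]; first by rewrite !big_ord0 !addr0 add0r addr_ge0.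
  rewrite [X in _ + X <= _]big_ord_recl [X in _ <= _ + (X + _)]big_ord_recr /=.
  rewrite (eq_bigr (fun i : 'I_L => g (Negz i))); last first.
    by move=> i _; congr g; rewrite /bump; lia.
  rewrite (_ : Negz 0 + 1 = 0) //.
  by have := g0 (Negz L); have := g0 (Negz L.+1); lra.
- rewrite /zsum [X in _ <= X + _]big_ord_recr [X in _ <= _ + X]big_ord_recl /=.
  rewrite [X in _ + X <= _](eq_bigr (fun i : 'I_L => g (Negz (bump 0 i)))); last first.
    by move=> i _; congr g; rewrite /bump; lia.
  case: L => [|L]; first by rewrite !big_ord0 !addr0 add0r addr_ge0.
  rewrite big_ord_recl [X in _ <= X + _ + _]big_ord_recr /=.
  rewrite (eq_bigr (fun i : 'I_L => g (Posz i))); last first.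
    by move=> i _; congr g; rewrite /bump; lia.
  rewrite (_ : 0 + -1 = Negz 0) //.
  by have := g0 (Posz L); have := g0 (Posz L.+1); lra.
Qed.

Definition height n x : nat := maxn `|n| (supnorm x).

(** Linear in the supremum norm between the cubes of radius [N] and [2 N]; the
truncated subtraction makes it vanish outside the larger one. *)
Definition cutoff (N : nat) n x : R :=
  (minn N (N + N - height n x))%:R / N%:R.

Lemma height_step n x a y : (`|a| <= 1)%N -> (supnorm y <= 1)%N ->
  (height (n + a) (x + y) <= (height n x).+1)%N /\
  (height n x <= (height (n + a) (x + y)).+1)%N.
Proof.
move=> a1 y1; have := supnormD x y; have := supnormD (x + y) (- y).
rewrite addrK supnormN /height.
move: (supnorm (x + y)) (supnorm x) (supnorm y) y1 => p q r; lia.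
Qed.

Lemma cutoff_ge0 N n x : 0 <= cutoff N n x.
Proof. by rewrite /cutoff divr_ge0. Qed.

Lemma cutoff_le1 N n x : cutoff N n x <= 1.
Proof.
case: N => [|N]; first by rewrite /cutoff invr0 mulr0.
by rewrite /cutoff ler_pdivrMr ?ltr0n // mul1r ler_nat geq_minl.
Qed.

Lemma cutoff1 N n x : (0 < N)%N -> (height n x <= N)%N -> cutoff N n x = 1.
Proof.
move=> N0 hN; rewrite /cutoff (_ : minn _ _ = N) ?divff ?pnatr_eq0 -?lt0n //; lia.
Qed.

Lemma cutoff0 N n x : (N + N <= height n x)%N -> cutoff N n x = 0.
Proof. by move=> hN; rewrite /cutoff (_ : minn _ _ = 0%N) ?mul0r //; lia. Qed.

Lemma cutoff_lip N n x a y : (`|a| <= 1)%N -> (supnorm y <= 1)%N ->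
  `|cutoff N (n + a) (x + y) - cutoff N n x| <= N%:R^-1.
Proof.
move=> a1 y1; have [h1 h2] := height_step n x a1 y1.
rewrite /cutoff -mulrBl normrM [`|N%:R^-1|]ger0_norm ?invr_ge0 //.
rewrite -[leRHS]mul1r ler_wpM2r ?invr_ge0 //.
move: (height _ _) (height _ _) h1 h2 => p q h1 h2.
set b := minn N _; set c := minn N _.
have [bc cb] : (b <= c.+1)%N /\ (c <= b.+1)%N by rewrite /b /c; lia.
move: bc cb; rewrite -!(ler_nat R) -!natr1 ler_norml; lra.
Qed.

End Cutoff.

(** * The cut-off equation *)

Section Core.
Variables (R : realType) (k : nat) (mu : R).
Local Notation C := R[i].
Local Notation T := 'rV[int]_k.
Variables (U F : int -> T -> C).
Hypothesis Ueq : forall n x, U (n + 1) x + U (n - 1) x = 2 * hop mu (U n) x + F n x.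

Definition steps : seq (int * T) :=
  [:: (1, 0); (- 1, 0)] ++ [seq (0, evec j) | j <- index_enum 'I_k]
    ++ [seq (0, - evec j) | j <- index_enum 'I_k].

Lemma size_steps : size steps = (2 * k.+1)%N.
Proof.
have E : size (index_enum 'I_k) = k by rewrite -[RHS](size_enum_ord k) enumT.
by rewrite /= size_cat !size_map E; lia.
Qed.

Lemma steps_small p : p \in steps -> (`|p.1| <= 1)%N /\ (supnorm p.2 <= 1)%N.
Proof.
rewrite !inE => /orP[/eqP->|/orP[/eqP->|]].
- by split=> //=; rewrite /supnorm big1 // => j _; rewrite mxE.
- by split=> //=; rewrite /supnorm big1 // => j _; rewrite mxE.
rewrite mem_cat => /orP[] /mapP[j _ ->] /=; split=> //.
  exact: supnorm_evec.
by rewrite supnormN supnorm_evec.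
Qed.

Lemma big_steps (V : nmodType) (f : int * T -> V) : \sum_(p <- steps) f p =
  f (1, 0) + f (- 1, 0) + \sum_(j < k) (f (0, evec j) + f (0, - evec j)).
Proof. by rewrite !big_cons big_cat !big_map big_split /= addrA. Qed.

Definition cutU N n x : C := (cutoff R N n x)%:C * U n x.
Definition cutF N n x : C := (cutoff R N n x)%:C * F n x.
Definition err N n x : C :=
  cutU N (n + 1) x + cutU N (n - 1) x - 2 * hop mu (cutU N n) x - cutF N n x.

(** The commutator of the operator with the cutoff: only increments of the
cutoff between neighbouring sites survive. *)
Lemma errE N n x : err N n x = \sum_(p <- steps)
  (cutoff R N (n + p.1) (x + p.2) - cutoff R N n x)%:C * U (n + p.1) (x + p.2).
Proof.
rewrite big_steps /= !addr0 /err /cutF.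
have -> : F n x = U (n + 1) x + U (n - 1) x - 2 * hop mu (U n) x by rewrite Ueq; ring.
rewrite /hop /cutU !rmorphB /=.
set c := (cutoff R N n x)%:C.
have -> : \sum_(j < k) ((cutoff R N n (x + evec j) - cutoff R N n x)%:C * U n (x + evec j)
    + (cutoff R N n (x - evec j) - cutoff R N n x)%:C * U n (x - evec j)) =
  \sum_(j < k) ((cutoff R N n (x + evec j))%:C * U n (x + evec j)
    + (cutoff R N n (x - evec j))%:C * U n (x - evec j)) -
  c * \sum_(j < k) (U n (x + evec j) + U n (x - evec j)).
  rewrite mulr_sumr -sumrB; apply: eq_bigr => j _; rewrite !rmorphB /= -/c; ring.
by field.
Qed.

Lemma err_bound N n x : (0 < N)%N -> normc (err N n x) ^+ 2 <=
  (2 * k.+1)%:R / N%:R ^+ 2 * \sum_(p <- steps) normc (U (n + p.1) (x + p.2)) ^+ 2.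
Proof.
move=> N0; rewrite errE.
apply: (@le_trans _ _ ((\sum_(p <- steps) N%:R^-1 * normc (U (n + p.1) (x + p.2))) ^+ 2)).
  rewrite lerXn2r ?nnegrE ?normc_ge0 //.
    by apply: sumr_ge0 => p _; rewrite mulr_ge0 ?normc_ge0 ?invr_ge0.
  apply: (le_trans (ler_normc_sum _ _ _)); rewrite big_seq [leRHS]big_seq.
  apply: ler_sum => p /steps_small[p1 p2].
  by rewrite normcM normc_real ler_wpM2r ?normc_ge0 // cutoff_lip.
rewrite -mulr_sumr exprMn exprVn [X in _ <= X * _]mulrC -mulrA ler_wpM2l ?invr_ge0 ?sqr_ge0 //.
by rewrite -size_steps; exact: sqr_sum_le.
Qed.

Lemma supported_cutU N n : supported (N + N) (cutU N n).
Proof. by move=> x xN; rewrite /cutU cutoff0 ?mul0r // /height; lia. Qed.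

Lemma supported_cutF N n : supported (N + N) (cutF N n).
Proof. by move=> x xN; rewrite /cutF cutoff0 ?mul0r // /height; lia. Qed.

Lemma err0 N n x : (N + N < height n x)%N -> err N n x = 0.
Proof.
move=> h; rewrite errE big_seq big1 // => p /steps_small[p1 p2].
have [h1 h2] := height_step n x p1 p2.
rewrite !cutoff0 ?subrr ?mul0r //; first exact: ltnW.
by rewrite -ltnS (leq_trans h).
Qed.

Lemma supported_err N n : supported (N + N).+1 (err N n).
Proof. by move=> x xN; apply: err0; rewrite /height; lia. Qed.

Definition boxmass L : R := zsum L (fun n =>
  lsum (fun x => if (supnorm x < L)%N then normc (U n x) ^+ 2 else 0)).

Lemma boxmass_shift L a y : (`|a| <= 1)%N -> (supnorm y <= 1)%N ->
  zsum L (fun n => lsum (fun x =>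
    if (supnorm x < L)%N then normc (U (n + a) (x + y)) ^+ 2 else 0)) <= boxmass L.+1.
Proof.
move=> a1 y1; pose g n := lsum (fun x => if (supnorm x < L.+1)%N then normc (U n x) ^+ 2 else 0).
have g0 n : 0 <= g n by apply: lsum_ge0 => x; case: ifP => // _; exact: sqr_ge0.
rewrite (le_trans _ (zsum_shift L g0 a1)) //; apply: ler_zsum => n.
rewrite /g -[leRHS](lsum_shift _ y); apply: (@ler_lsum _ _ L.+2).
- by move=> x xL; rewrite ltnNge (leq_trans _ xL) // ltnW.
- apply: (@supported_shift _ _ L.+1 (fun x => if (supnorm x < L.+1)%N then normc (U (n + a) x) ^+ 2 else 0)) => //.
  by move=> x; rewrite leqNgt => /negbTE ->.
move=> x /=; case: ifP => [xL|_]; last by case: ifP => // _; exact: sqr_ge0.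
by rewrite ifT // ltnS (leq_trans (supnormD x y)) // (leq_trans (leq_add (leqnn _) y1)) // addn1.
Qed.

(** Increments of the cutoff are at most [1 / N], so the square sum of the
commutator is of order [N ^- 2] times the mass of [U], hence [o(1 / N)] under
the growth hypothesis. *)
Lemma err_mass N : (0 < N)%N ->
  zsum (N + N).+1 (fun n => lsum (fun x => normc (err N n x) ^+ 2)) <=
  (2 * k.+1)%:R ^+ 2 / N%:R ^+ 2 * boxmass (N + N).+2.
Proof.
move=> N0; set L := (N + N).+1.
pose h p n := lsum (fun x => if (supnorm x < L)%N then normc (U (n + p.1) (x + p.2)) ^+ 2 else 0).
have hs n (p : int * T) : supported L (fun x => if (supnorm x < L)%N then normc (U (n + p.1) (x + p.2)) ^+ 2 else 0).
  by move=> x; rewrite leqNgt => /negbTE ->.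
apply: (@le_trans _ _ (zsum L (fun n => (2 * k.+1)%:R / N%:R ^+ 2 * \sum_(p <- steps) h p n))).
  apply: ler_zsum => n; rewrite /h -(@lsum_sum _ _ L _ _ (fun p x => if (supnorm x < L)%N then normc (U (n + p.1) (x + p.2)) ^+ 2 else 0)) // -lsumZ; apply: (@ler_lsum _ _ L).
  - by move=> x xL; rewrite supported_err // normc0 expr0n.
  - by move=> x xL; rewrite big1 ?mulr0 // => p _; rewrite hs.
  move=> x; have [xL|xL] := ltnP (supnorm x) L; first exact: err_bound.
  by rewrite big1 // mulr0 supported_err ?normc0 ?expr0n.
have H : \sum_(p <- steps) zsum L (h p) <= (2 * k.+1)%:R * boxmass L.+1.
  apply: (@le_trans _ _ (\sum_(p <- steps) boxmass L.+1)).
    rewrite big_seq [leRHS]big_seq; apply: ler_sum => p /steps_small[p1 p2].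
    exact: boxmass_shift.
  by rewrite big_const_seq count_predT iter_addr_0 size_steps mulr_natl.
rewrite zsumZ zsum_sum (le_trans (ler_wpM2l _ H)) ?divr_ge0 ?sqr_ge0 //.
by rewrite le_eqVlt; apply/orP; left; apply/eqP; ring.
Qed.
End Core.

(** * The Fourier transform of the cut-off equation *)

Section Slices.
Variables (R : realType) (k : nat) (mu : R).
Local Notation C := R[i].
Local Notation T := 'rV[int]_k.
Variables (U F : int -> T -> C).
Hypothesis Ueq : forall n x, U (n + 1) x + U (n - 1) x = 2 * hop mu (U n) x + F n x.
Hypothesis F0 : forall n x, 0 <= n -> F n x = 0.

(** Summing absolute values over all slices is what a unimodular
characteristic root requires: it transports the source without damping. *)
Definition errsum N (xi : 'I_k -> R) : R :=
  zsum (N + N).+1 (fun n => normc (ft (err mu U F N n) xi)).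

(** For the two choices of initial values these are, after a linear change,
the Cauchy data at the origin of the solution that vanishes on the far left
and is driven by the cut-off source alone. *)
Definition extrap (x0 x1 : C) N (xi : 'I_k -> R) : C :=
  \sum_(j < (N + N).+1) cheb x0 x1 (symbol mu xi)%:C j * ft (cutF F N (Negz j)) xi.

Lemma ft_rec N xi n :
  ft (cutU U N (n + 1)) xi + ft (cutU U N (n - 1)) xi
    - 2 * (symbol mu xi)%:C * ft (cutU U N n) xi
  = ft (err mu U F N n) xi + ft (cutF F N n) xi.
Proof.
pose L := (N + N).+1.
have sU m : supported L (cutU U N m) by apply: (supported_le (leqnSn _)); exact: supported_cutU.
have sF m : supported L (cutF F N m) by apply: (supported_le (leqnSn _)); exact: supported_cutF.
have sE m : supported L (err mu U F N m) by move=> x; exact: (supported_err Ueq).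
have sH : supported L (hop mu (cutU U N n)) by apply: supported_hop; exact: supported_cutU.
rewrite -(ftD xi (sE n) (sF n)) -mulrA -(ft_hop mu xi (sU n)) -ftZ -(ftD xi (sU _) (sU _)).
apply/eqP; rewrite subr_eq; apply/eqP.
rewrite -(@ftD _ _ L); first 1 last.
- by move=> x Lx; rewrite sE // sF // addr0.
- by move=> x Lx; rewrite sH // mulr0.
by congr (ft _ xi); apply/funext => x; rewrite /err; ring.
Qed.

Lemma ft_cutU0 N xi n : (N + N <= `|n|)%N -> ft (cutU U N n) xi = 0.
Proof.
move=> Nn; rewrite /ft /lsum fsbig1 // => x _.
by rewrite /cutU cutoff0 ?mul0r // /height leq_max Nn.
Qed.

Lemma ft_cutF0 N xi n : 0 <= n -> ft (cutF F N n) xi = 0.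
Proof.
by move=> n0; rewrite /ft /lsum fsbig1 // => x _; rewrite /cutF F0 // mulr0 mul0r.
Qed.

Lemma extrap_oscillating N xi (r : R) : 0 < r -> symbol mu xi ^+ 2 + r ^+ 2 <= 1 ->
  normc (extrap 0 1 N xi) <= errsum N xi / r /\
  normc (extrap 1 0 N xi) <= errsum N xi + errsum N xi / r.
Proof.
move=> r0 xir.
exact: (rec_oscillating (fun n => @ft_cutU0 N xi n) (fun n => ft_rec N xi n)
  (fun n => @ft_cutF0 N xi n) r0 xir).
Qed.

Lemma ft_cutU_bound N xi (n : nat) :
  `|symbol mu xi ^+ 2 - 1| * normc (ft (cutU U N n) xi) <=
  (`|symbol mu xi| + 1) *
    (errsum N xi + normc (extrap 0 1 N xi) + normc (extrap 1 0 N xi)).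
Proof.
exact: (rec_bound (fun n => @ft_cutU0 N xi n) (fun n => ft_rec N xi n)
  (fun n => @ft_cutF0 N xi n) n).
Qed.

Lemma errsum_ge0 N xi : 0 <= errsum N xi.
Proof. by apply: zsum_ge0 => n; exact: normc_ge0. Qed.

(** Parseval in each slice bounds the mean square of a single term; passing to
the sum over the [O(N)] slices costs, by Cauchy-Schwarz, a factor of order
[N]. *)
Lemma errsum_grid N K xi : (0 < N)%N -> (4 * N + 2 < K)%N ->
  \sum_(a : {ffun 'I_k -> 'I_K}) errsum N (gridpt xi a) ^+ 2 <=
  (K ^ k)%:R * ((4 * N + 2)%:R * ((2 * k.+1)%:R ^+ 2 / N%:R ^+ 2 * boxmass U (N + N).+2)).
Proof.
move=> N0 NK; set L := (N + N).+1.
apply: (@le_trans _ _ (\sum_(a : {ffun 'I_k -> 'I_K}) (L + L)%:R *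
    zsum L (fun n => normc (ft (err mu U F N n) (gridpt xi a)) ^+ 2))).
  by apply: ler_sum => a _; exact: zsum_sqr.
rewrite -mulr_sumr -zsum_sum.
have -> : zsum L (fun n => \sum_(a : {ffun 'I_k -> 'I_K})
      normc (ft (err mu U F N n) (gridpt xi a)) ^+ 2) =
    (K ^ k)%:R * zsum L (fun n => lsum (fun x => normc (err mu U F N n x) ^+ 2)).
  rewrite -zsumZ; congr zsum; apply/funext => n; apply: (@parseval _ _ _ L).
    exact: supported_err.
  by rewrite /L; lia.
rewrite mulrCA ler_wpM2l // (_ : (L + L)%N = (4 * N + 2)%N); last by rewrite /L; lia.
by rewrite ler_wpM2l //; exact: err_mass.
Qed.

(** The factor of order [N] from Cauchy-Schwarz is exactly what the bound
[o(1 / N)] on the commutator can pay for. *)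
Lemma errsum_average (e : R) : 0 < e ->
  (forall e, 0 < e -> exists L0, forall L, (L0 <= L)%N -> boxmass U L <= e * L%:R) ->
  exists N0, forall N, (N0 <= N)%N -> forall K xi, (4 * N + 2 < K)%N ->
  \sum_(a : {ffun 'I_k -> 'I_K}) errsum N (gridpt xi a) ^+ 2 <= e * (K ^ k)%:R.
Proof.
move=> e0 hU; set m : R := (2 * k.+1)%:R.
have m0 : 0 < m by rewrite ltr0n.
have e'0 : 0 < e / (24 * m ^+ 2) by rewrite divr_gt0 // mulr_gt0 // exprn_gt0.
have [L0 HL] := hU _ e'0; exists (L0 + 1)%N => N NL K xi NK.
have N0 : (0 < N)%N by lia.
apply: (le_trans (errsum_grid xi N0 NK)); rewrite mulrC ler_wpM2r //.
have /HL HB : (L0 <= (N + N).+2)%N by lia.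
have N0R : (0 : R) < N%:R by rewrite ltr0n.
have N1R : (1 : R) <= N%:R by rewrite ler1n.
apply: (@le_trans _ _ ((6 * N%:R) * (m ^+ 2 / N%:R ^+ 2 * (e / (24 * m ^+ 2) * (4 * N%:R))))).
  apply: ler_pM => //.
  - by rewrite mulr_ge0 ?divr_ge0 ?sqr_ge0 // zsum_ge0 // => n; apply: lsum_ge0 => x;
      case: ifP => // _; exact: sqr_ge0.
  - by rewrite natrD natrM; lra.
  rewrite ler_wpM2l ?divr_ge0 ?sqr_ge0 //; apply: (le_trans HB); rewrite ler_pM2l //.
  by rewrite -addn2 !natrD; lra.
by rewrite le_eqVlt; apply/orP; left; apply/eqP; field; rewrite !gt_eqF.
Qed.

End Slices.

(** * Uniform bounds along frequency lines *)

Section Lines.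
Variables (R : realType) (k : nat) (mu : R).
Local Notation C := R[i].
Local Notation T := 'rV[int]_k.
Implicit Types xi eta : 'I_k -> R.

Definition line xi eta (t : R) : 'I_k -> R := fun j => xi j + t * eta j.

Lemma expsum_ft L (g : T -> C) xi eta : supported L g -> (forall j, `|eta j| <= 8) ->
  expsum (lsum (fun x => normc (g x) * expR 16 ^+ onenorm x))
    (fun t => ft g (line xi eta t)).
Proof.
move=> gL eta8; pose b (x : T) : R := \sum_(j < k) (x ord0 j)%:~R * eta j.
rewrite (@lsumE _ _ L); last by move=> x Lx; rewrite gL // normc0 mul0r.
have E t : \sum_(i : {ffun 'I_k -> 'I_(L + L)})
    g (boxpt i) * chi xi (boxpt i) * cis (t * b (boxpt i)) = ft g (line xi eta t).
  rewrite /ft (@lsumE _ _ L); last exact: supportedMr.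
  apply: eq_bigr => i _; rewrite -mulrA /chi -cisD; congr (_ * cis _).
  rewrite mulr_sumr -big_split; apply: eq_bigr => j _.
  by rewrite /line mulrDr mulrCA.
apply: (eq_expsum E).
have H := expsum_sum (index_enum {ffun 'I_k -> 'I_(L + L)})
  (fun i => expsum_cis (g (boxpt i) * chi xi (boxpt i)) (b (boxpt i))).
apply: (expsum_le _ H); apply: ler_sum => i _.
rewrite normcM normc_chi mulr1 ler_wpM2l ?normc_ge0 // -expRM_natl ler_expR.
suff : `|b (boxpt i)| <= 8 * (onenorm (boxpt i))%:R by lra.
rewrite /b /onenorm natr_sum mulr_sumr (le_trans (ler_norm_sum _ _ _)) //.
apply: ler_sum => j _; rewrite normrM mulrC ler_pM //.
by rewrite natr_absz intr_norm.
Qed.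

Lemma expsum_symbol xi eta : (forall j, `|eta j| <= 8) ->
  expsum (`|mu| / 2 + k%:R * expR 16) (fun t => (symbol mu (line xi eta t))%:C).
Proof.
move=> eta8; pose h j t : C := (- 2^-1 * cis (xi j)) * cis (t * eta j) +
  (- 2^-1 * cis (- xi j)) * cis (t * - eta j).
have E t : (mu / 2)%:C + \sum_(j < k) h j t = (symbol mu (line xi eta t))%:C.
  rewrite /symbol rmorphB rmorph_sum -sumrN; congr (_ + _); apply: eq_bigr => j _.
  rewrite /h -!mulrA -!cisD mulrN -opprD -mulrDr cisDcisN rmorphM rmorph_nat /line.
  by field.
have hj j : expsum (expR 16) (h j).
  apply: (expsum_le _ (expsumD (expsum_cis _ _) (expsum_cis _ _))).
  rewrite !normcM !normc_cis normcNE normcV normc_nat normrN -mulrDr mulr1.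
  rewrite [X in _ * X <= _](_ : _ = 2 * expR (2 * `|eta j|)); last by ring.
  rewrite mulrA mulVf // mul1r ler_expR; have := eta8 j; lra.
apply: (eq_expsum E); apply: (expsum_le _ (expsumD (expsum_const _) (expsum_sum (index_enum 'I_k) hj))).
rewrite normc_real normrM [`|2^-1|]ger0_norm // lerD2l.
by rewrite sumr_const card_ord mulr_natl.
Qed.

Variable F : int -> T -> C.
Hypothesis Fdecay : forall D : R, 1 <= D ->
  exists C0 : R, forall n x, normc (F n x) * D ^+ (`|n| + onenorm x) <= C0.

(** The superexponential decay of the source dominates both the exponential
growth in [j] of the Chebyshev polynomials and the exponential weights of the
exponential sums, uniformly in the cutoff. *)
Lemma expsum_extrap : exists M : R, forall (x0 x1 : C) N xi eta,
  normc x0 <= 1 -> normc x1 <= 1 -> (forall j, `|eta j| <= 8) ->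
  expsum M (fun t => extrap mu F x0 x1 N (line xi eta t)).
Proof.
(* [16] is twice the bound [8] on the components of the direction, and [8]
exceeds [2 pi]. *)
pose B : R := `|mu| / 2 + k%:R * expR 16; pose D := 2 * B + 1; pose D0 : R := expR 16.
have B0 : 0 <= B by rewrite addr_ge0 ?divr_ge0 // mulr_ge0 // expR_ge0.
have D1 : 1 <= D by rewrite /D; lra.
have D01 : 1 <= D0 by rewrite /D0 -expR0 ler_expR.
(* The factor [2] leaves geometric weights in [j] and in the position. *)
have DD0 : 1 <= 2 * (D * D0) by nra.
have [C0 HC] := Fdecay DD0.
have C00 : 0 <= C0.
  by apply: le_trans (HC 0 0); rewrite mulr_ge0 ?normc_ge0 // exprn_ge0 //; lra.
exists (2 * (C0 * 3 ^+ k)) => x0 x1 N xi eta nx0 nx1 eta8.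
have H (j : 'I_(N + N).+1) := expsumM (expsum_cheb j nx0 nx1 (expsum_symbol xi eta8) B0 (lexx _))
  (expsum_ft xi (@supported_cutF _ _ F N (Negz j)) eta8).
apply: (expsum_le _ (expsum_sum (index_enum 'I_(N + N).+1) H)) => {H}.
apply: (@le_trans _ _ (\sum_(j < (N + N).+1) 2^-1 ^+ j * (C0 * 3 ^+ k))); last first.
  rewrite -mulr_suml ler_wpM2r ?mulr_ge0 ?exprn_ge0 //.
  rewrite sum_half_powers; have : 0 <= (2^-1 : R) ^+ (N + N).+1 by rewrite exprn_ge0 ?invr_ge0.
  lra.
apply: ler_sum => j _; rewrite -/B -/D -/D0.
apply: (@le_trans _ _ (2^-1 ^+ j * (C0 * lsum (fun x : T =>
    if (supnorm x < N + N)%N then (2^-1 : R) ^+ onenorm x else 0)))); last first.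
  by rewrite ler_wpM2l ?exprn_ge0 ?invr_ge0 // ler_wpM2l // lsum_geometric.
rewrite -!lsumZ; apply: (@ler_lsum _ _ (N + N)).
- by move=> x Nx; rewrite supported_cutF // normc0 mul0r mulr0.
- by move=> x Nx; rewrite ltnNge Nx /= !mulr0.
move=> x; have [Nx|Nx] := ltnP (supnorm x) (N + N); last first.
  by rewrite supported_cutF // normc0 mul0r !mulr0.
have Dj : 0 < D ^+ j by rewrite exprn_gt0 //; lra.
have D0x : 0 < D0 ^+ onenorm x by rewrite exprn_gt0 //; lra.
have P2 n : (0 : R) < 2 ^+ n by rewrite exprn_gt0.
have Hx : normc (F (Negz j) x) * (2 ^+ j * 2 ^+ onenorm x * (D ^+ j * D0 ^+ onenorm x)) <= C0.
  apply: le_trans (HC (Negz j) x); rewrite ler_wpM2l ?normc_ge0 //=.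
  rewrite exprD !exprMn -!mulrA.
  have DDj : 1 <= 2 * (D * D0 ^+ j.+1).
    have : 1 <= D0 ^+ j.+1 by rewrite exprn_ege1.
    by move=> ?; nra.
  have DDx : 1 <= D ^+ onenorm x by rewrite exprn_ege1.
  rewrite !exprS.
  set a := 2 ^+ j; set b := 2 ^+ onenorm x; set c := D ^+ j; set d := D0 ^+ onenorm x.
  set e := D ^+ onenorm x in DDx *; rewrite exprS in DDj; set f := D0 ^+ j in DDj *.
  have a0 : 0 <= a by exact: ltW (P2 _).
  have b0 : 0 <= b by exact: ltW (P2 _).
  have p : 0 <= a * b * c * d by rewrite !mulr_ge0 // ltW.
  have q : 1 <= (2 * (D * (D0 * f))) * e by have := ler_pM ler01 ler01 DDj DDx; rewrite mulr1.
  rewrite [leLHS](_ : _ = a * b * c * d * 1); last by ring.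
  rewrite [leRHS](_ : _ = a * b * c * d * (2 * (D * (D0 * f)) * e)); last by ring.
  by rewrite ler_wpM2l.
have nF : normc (cutF F N (Negz j) x) <= normc (F (Negz j) x).
  rewrite /cutF normcM normc_real ger0_norm ?cutoff_ge0 // ler_piMl ?normc_ge0 //.
  exact: cutoff_le1.
rewrite !exprVn mulrCA -ler_pdivrMl ?invr_gt0 // invrK.
rewrite ler_pdivlMr //; apply: le_trans Hx.
rewrite mulrCA [leRHS](_ : _ = normc (F (Negz j) x) * (D0 ^+ onenorm x) * (2 ^+ j * D ^+ j * 2 ^+ onenorm x)); last by ring.
rewrite [leLHS](_ : _ = normc (cutF F N (Negz j) x) * (D0 ^+ onenorm x) * (2 ^+ j * D ^+ j * 2 ^+ onenorm x)); last by ring.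
rewrite ler_wpM2r ?mulr_ge0 // ?(ltW Dj) //.
by rewrite ler_wpM2r // ltW.
Qed.

End Lines.

(** * Vanishing of the slices beyond the source *)

Lemma grid_pigeonhole (R : realType) (k K M : nat) (g : {ffun 'I_k -> 'I_K} -> R) (c : R) :
  (0 < M <= K)%N -> (forall a, 0 <= g a) -> \sum_a g a <= c * (M ^ k)%:R ->
  exists a : {ffun 'I_k -> 'I_K}, (forall j, a j < M)%N /\ g a <= c.
Proof.
case/andP=> M0 MK g0 gc; pose P : pred 'I_K := fun i => (i < M)%N.
have cP : #|P| = M.
  by rewrite -sum1_card (big_ord_narrow MK) sum1_card card_ord.
have cF : #|@ffun_on 'I_k P| = (M ^ k)%N by rewrite card_ffun_on cP card_ord.
apply/not_existsP => H.
have : c * (M ^ k)%:R < \sum_(a | a \in @ffun_on 'I_k P) g a.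
  rewrite mulr_natr -cF -sumr_const; apply: ltr_sum => [|a /ffun_onP aP].
    apply/hasP; pose i0 := Ordinal (leq_trans M0 MK).
    exists [ffun => i0]; first by rewrite mem_index_enum.
    by apply/ffun_onP => j; rewrite ffunE; exact: M0.
  rewrite ltNge; apply/negP => gac; by apply: (H a); split.
apply/negP; rewrite -leNgt (le_trans _ gc) //.
rewrite [leRHS](bigID (fun a => a \in @ffun_on 'I_k P)) /= lerDl.
exact: sumr_ge0.
Qed.

Lemma le_truncn (R : realType) (x : R) : x <= (Num.truncn `|x|).+1%:R.
Proof. by rewrite (le_trans (ler_norm x)) // ltW // truncnS_gt. Qed.

Section Uniqueness.
Variables (R : realType) (k : nat) (mu : R).
Local Notation C := R[i].
Local Notation T := 'rV[int]_k.
Variables (U F : int -> T -> C).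
Hypothesis Ueq : forall n x, U (n + 1) x + U (n - 1) x = 2 * hop mu (U n) x + F n x.
Hypothesis F0 : forall n x, 0 <= n -> F n x = 0.
Hypothesis Fdecay : forall D : R, 1 <= D ->
  exists C0 : R, forall n x, normc (F n x) * D ^+ (`|n| + onenorm x) <= C0.
Hypothesis Umass : forall e : R, 0 < e ->
  exists L0, forall L, (L0 <= L)%N -> boxmass U L <= e * L%:R.
Variables (th rho kap : R).
Hypothesis th04 : 0 <= th <= 4.
Hypothesis rho0 : 0 < rho.
Hypothesis kap01 : 0 < kap <= 1.
Hypothesis oscillating : forall xi : 'I_k -> R,
  (forall j, `|xi j - th| <= 2 * rho) -> symbol mu xi ^+ 2 + kap ^+ 2 <= 1.

(** In the oscillating region the extrapolated data are bounded by [errsum],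
which is small only in mean square over a grid of frequencies. The grid can be
shifted to start at any prescribed frequency [xi]; a positive fraction of it
lies near [xi], so some grid point near [xi] has small [errsum], and a
Lipschitz bound transports the estimate to [xi]. *)
Lemma extrap_ball (e : R) : 0 < e -> exists N0, forall N, (N0 <= N)%N ->
  forall xi : 'I_k -> R, (forall j, `|xi j - th| <= rho) ->
  normc (extrap mu F 0 1 N xi) <= e /\ normc (extrap mu F 1 0 N xi) <= e.
Proof.
move=> e0; have [kap0 kap1] := andP kap01.
have [M HM] := expsum_extrap mu Fdecay.
have M0 : 0 <= M.
  have := expsum_lip 1 0 (HM 0 0 0%N (fun=> 0) (fun=> 0) _ _ _).
  rewrite normc0 normr0 subr0 normr1 mulr1 => /(_ ler01 ler01 (fun=> ler0n _ _)).
  exact: le_trans (normc_ge0 _).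
(* The sub-box of side [M'] in the grid of side [Q * M'] has diameter less
than [2 pi / Q]; [Q] is chosen so that this is below [rho] and so that the
Lipschitz error is below [e / 2]. *)
set q : R := 8 / rho + 2 * M / e; pose Q := (Num.truncn `|q|).+1.
have q0 : 0 <= q by rewrite addr_ge0 // divr_ge0 ?mulr_ge0 // ltW.
have qQ : q <= Q%:R by exact: le_truncn.
have Q0 : (0 : R) < Q%:R by rewrite ltr0n.
have Q8 : 8 / Q%:R <= rho.
  rewrite ler_pdivrMr // -ler_pdivrMl // mulrC (le_trans _ qQ) // lerDl.
  by rewrite divr_ge0 ?mulr_ge0 // ltW.
have QM : M / Q%:R <= e / 2.
  rewrite ler_pdivrMr // mulrAC ler_pdivlMr // -ler_pdivrMl // mulrC [M * 2]mulrC (le_trans _ qQ) // lerDr.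
  by rewrite divr_ge0 // ltW.
pose del := kap * e / 4.
have del0 : 0 < del by rewrite divr_gt0 // mulr_gt0.
have Qk0 : (0 : R) < (Q ^ k)%:R by rewrite ltr0n expn_gt0.
have e'0 : 0 < del ^+ 2 / (Q ^ k)%:R by rewrite divr_gt0 // exprn_gt0.
have [N0 HN] := errsum_average Ueq e'0 Umass.
exists N0 => N NN xi xith.
pose M' := (4 * N + 3)%N; pose K := (Q * M')%N.
have M'0 : (0 : R) < M'%:R by rewrite ltr0n /M' addn3.
have M'K : (M' <= K)%N by rewrite /K leq_pmull.
have NK : (4 * N + 2 < K)%N by rewrite (leq_trans _ M'K) // /M' ltn_add2l.
have S := HN N NN K xi NK.
have [||a [aM aE]] := @grid_pigeonhole R k K M'
  (fun a => errsum mu U F N (gridpt xi a) ^+ 2) (del ^+ 2) _ (fun=> sqr_ge0 _).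
- by rewrite M'K andbT /M' addn3.
- rewrite (le_trans S) // /K expnMn natrM mulrA divfK // gt_eqF //.
have aE' : errsum mu U F N (gridpt xi a) <= del.
  by rewrite -(ler_pXn2r (n := 2)) ?nnegrE ?(ltW del0) // errsum_ge0.
pose eta : 'I_k -> R := fun j => 2 * pi * (a j)%:R / M'%:R.
have eta0 j : 0 <= eta j.
  by rewrite /eta divr_ge0 // !mulr_ge0 // pi_ge0.
have eta8 j : `|eta j| <= 8.
  rewrite ger0_norm // /eta ler_pdivrMr //; apply: ler_pM => //.
  - by rewrite mulr_ge0 // pi_ge0.
  - have := @pihalf_lt2 R; lra.
  - by rewrite ler_nat ltnW.
have Eg : gridpt xi a = line xi eta Q%:R^-1.
  apply/funext => j; rewrite /gridpt /line /eta /K natrM; congr (_ + _).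
  by field; rewrite !gt_eqF.
have Ex : xi = line xi eta 0 by apply/funext => j; rewrite /line mul0r addr0.
have osc : symbol mu (gridpt xi a) ^+ 2 + kap ^+ 2 <= 1.
  apply: oscillating => j; rewrite Eg /line addrAC.
  rewrite (le_trans (ler_normD _ _)) // mulr_natl mulr2n lerD //.
  rewrite normrM [`|Q%:R^-1|]ger0_norm ?invr_ge0 // (le_trans _ Q8) // mulrC.
  by rewrite ler_pM2r ?invr_gt0.
have [X1 X2] := extrap_oscillating Ueq F0 N kap0 osc.
have dk : del / kap = e / 4 by rewrite /del; field; rewrite gt_eqF.
have Ek : errsum mu U F N (gridpt xi a) / kap <= e / 4.
  by rewrite -dk ler_pM2r // invr_gt0.
have del4 : del <= e / 4 by rewrite /del ler_pM2r // ler_piMl // ltW.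
have close x0 x1 : normc x0 <= 1 -> normc x1 <= 1 ->
    normc (extrap mu F x0 x1 N xi) <= normc (extrap mu F x0 x1 N (gridpt xi a)) + e / 2.
  move=> nx0 nx1; have := expsum_lip 0 Q%:R^-1 (HM x0 x1 N xi eta nx0 nx1 eta8).
  rewrite -Ex -Eg sub0r normrN [`|Q%:R^-1|]ger0_norm ?invr_ge0 // => H.
  rewrite -[X in normc X <= _](subrK (extrap mu F x0 x1 N (gridpt xi a))).
  rewrite (le_trans (ler_normcD _ _)) // addrC lerD2l (le_trans H) //.
have C1 := close 0 1; have C2 := close 1 0; rewrite !normc0 !normc1 in C1 C2.
have := C1 ler01 (lexx _); have := C2 (lexx _) ler01; split; lra.
Qed.

(** Continuation along the segment from the centre of the oscillating ball to
[xi]; all constants are independent of [xi] and of the cutoff. *)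
Lemma extrap_uniform (e : R) : 0 < e -> exists N0, forall N, (N0 <= N)%N ->
  forall xi : 'I_k -> R, (forall j, `|xi j - th| <= 8) ->
  normc (extrap mu F 0 1 N xi) <= e /\ normc (extrap mu F 1 0 N xi) <= e.
Proof.
move=> e0; have [M HM] := expsum_extrap mu Fdecay.
(* [J] makes the high finite differences small; [P] puts the first [J] sample
points inside the ball. *)
pose J := (Num.truncn `|2 * M / e|).+1.
have J2 : M / 2 ^+ J <= e / 2.
  rewrite ler_pdivrMr ?exprn_gt0 // mulrAC ler_pdivlMr // mulrC -ler_pdivrMl //.
  rewrite [leLHS](_ : _ = 2 * M / e); last by ring.
  rewrite (le_trans (le_truncn _)) // -/J -natrX ler_nat ltnW // ltn_expl //.
pose P := (Num.truncn `|8 * J%:R / rho|).+1.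
have P0 : (0 : R) < P%:R by rewrite ltr0n.
have PJ : 8 * J%:R / P%:R <= rho.
  by rewrite ler_pdivrMr // -ler_pdivrMl // mulrC; exact: le_truncn.
pose e' := e / 2 / 3 ^+ P.
have e'0 : 0 < e' by rewrite !divr_gt0 // exprn_gt0.
have [N0 HN] := extrap_ball e'0.
exists N0 => N NN xi xith.
pose eta j := xi j - th.
have main x0 x1 : normc x0 <= 1 -> normc x1 <= 1 ->
    (forall z : 'I_k -> R, (forall j, `|z j - th| <= rho) -> normc (extrap mu F x0 x1 N z) <= e') ->
    normc (extrap mu F x0 x1 N xi) <= e.
  move=> nx0 nx1 H.
  have HX := HM x0 x1 N (fun=> th) eta nx0 nx1 xith.
  have -> : xi = line (fun=> th) eta 1.
    by apply/funext => j; rewrite /line /eta mul1r addrC subrK.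
  apply: (le_trans (expsum_continuation (N := P) (J := J) (eta := e') HX _ _ (ltW e'0))) => //.
    move=> l lJ; apply: H => j; rewrite /line addrAC subrr add0r normrM ger0_norm //.
    rewrite (le_trans _ PJ) // mulrAC ler_pM2r ?invr_gt0 // mulrC ler_pM //.
      exact: xith.
    by rewrite ler_nat ltnW.
  rewrite /e' [3 ^+ P * _]mulrC divfK ?gt_eqF ?exprn_gt0 //; lra.
split; apply: main; rewrite ?normc0 ?normc1 // => z Hz.
  by have [] := HN N NN z Hz.
by have [] := HN N NN z Hz.
Qed.

Lemma hop_local (g h : T -> C) x :
  (forall y, (supnorm y <= (supnorm x).+1)%N -> g y = h y) -> hop mu g x = hop mu h x.
Proof.
move=> gh; rewrite /hop gh //; congr (_ - _ * _); apply: eq_bigr => j _.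
rewrite !gh //; apply: (leq_trans (supnormD _ _)).
  by rewrite supnormN -addn1 leq_add2l supnorm_evec.
by rewrite -addn1 leq_add2l supnorm_evec.
Qed.

Lemma symbol_le (xi : 'I_k -> R) : `|symbol mu xi| + 1 <= `|mu| / 2 + k%:R + 1.
Proof.
rewrite lerD2r /symbol (le_trans (ler_normB _ _)) // normrM [`|2^-1|]ger0_norm // lerD2l.
rewrite (le_trans (ler_norm_sum _ _ _)) //.
rewrite -[k%:R](_ : \sum_(j < k) (1 : R) = _); last by rewrite sumr_const card_ord.
by apply: ler_sum => j _; exact: cos_max.
Qed.

(** By [ft_cutU_bound] the Fourier transform of the cut-off slice is small
after multiplication by [symbol ^+ 2 - 1], again in mean square over a grid.
Parseval turns this into a pointwise bound on [hop (hop v) - v], and near [x]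
the cutoff is one. *)
Lemma hop_hop (n : nat) x : hop mu (hop mu (U n%:Z)) x = U n%:Z x.
Proof.
pose B : R := `|mu| / 2 + k%:R + 1.
have B1 : 1 <= B by rewrite /B lerDr addr_ge0 // divr_ge0.
pose t := hop mu (hop mu (U n%:Z)) x - U n%:Z x.
(* [9 = 3 * (1 + 1 + 1)]: three terms in a square of a sum, each contributing
at most [e]. *)
suff H e : 0 < e -> e <= 1 -> normc t ^+ 2 <= 9 * B ^+ 2 * e.
  apply/eqP; rewrite -subr_eq0 -/t; apply/negPn/negP => t0.
  have tp : 0 < normc t.
    by rewrite lt_def normc_ge0 andbT; apply: contra t0 => /eqP/eq0_normc ->.
  pose q := normc t ^+ 2; have q0 : 0 < q by rewrite exprn_gt0.
  have B20 : 0 < 18 * B ^+ 2 by rewrite mulr_gt0 // exprn_gt0 //; lra.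
  have e0 : 0 < Num.min 1 (q / (18 * B ^+ 2)) by rewrite lt_min ltr01 divr_gt0.
  have := H _ e0; rewrite ge_min lexx => /(_ isT); rewrite -/q.
  have : 9 * B ^+ 2 * Num.min 1 (q / (18 * B ^+ 2)) <= q / 2.
    rewrite (_ : q / 2 = 9 * B ^+ 2 * (q / (18 * B ^+ 2))); last first.
      by field; rewrite gt_eqF //; lra.
    by rewrite ler_pM2l ?ge_min ?lexx ?orbT // mulr_gt0 // exprn_gt0 //; lra.
  lra.
move=> e0 e1.
have [N1 H1] := errsum_average Ueq e0 Umass.
have [N2 H2] := extrap_uniform e0.
pose N := (N1 + N2 + n + supnorm x + 2)%N.
have {}H1 := H1 N (ltac:(rewrite /N; lia)).
have {}H2 := H2 N (ltac:(rewrite /N; lia)).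
pose v := cutU U N n%:Z.
pose g y := hop mu (hop mu v) y + (- 1) * v y.
pose L := (N + N).+2.
have sv : supported (N + N) v by exact: supported_cutU.
have shv := supported_hop mu sv.
have sg1 : supported L (hop mu (hop mu v)) by exact: supported_hop.
have sg2 : supported L (fun y => -1 * v y).
  by move=> y Ly; rewrite sv ?mulr0 // (leq_trans _ Ly) // /L; lia.
have sg : supported L g by move=> y Ly; rewrite /g sg1 // sg2 // addr0.
have vU y : (supnorm y <= (supnorm x).+2)%N -> v y = U n%:Z y.
  move=> yx; rewrite /v /cutU cutoff1 ?mul1r //; first by rewrite /N; lia.
  by rewrite /height geq_max /N; move: (supnorm y) (supnorm x) yx => p q; lia.
have -> : t = g x.
  rewrite /t /g mulN1r vU; last by rewrite -addn2 leq_addr.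
  congr (_ - _); apply: hop_local => y yx; apply: hop_local => z zy.
  by rewrite vU // (leq_trans zy).
(* The support of [g] has diameter at most [4 N + 4]. *)
pose K := (4 * N + 5)%N.
have K0 : (0 : R) < (K ^ k)%:R by rewrite ltr0n expn_gt0 /K addnS.
have LK : (L + L < K)%N by rewrite /L /K; lia.
have P := parseval (fun=> 0) sg LK.
have {}H1 := H1 K (fun=> 0) (ltac:(rewrite /K; lia)).
have : normc (g x) ^+ 2 <= lsum (fun x => normc (g x) ^+ 2).
  apply: (@ler_lsum_pt _ _ L (fun x => normc (g x) ^+ 2)) => [y Ly|y].
    by rewrite sg // normc0 expr0n.
  exact: sqr_ge0.
move/le_trans; apply.
rewrite -(ler_pM2l K0) -P.
apply: (@le_trans _ _ (\sum_(a : {ffun 'I_k -> 'I_K})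
   (3 * B ^+ 2 * (errsum mu U F N (gridpt (fun=> 0) a) ^+ 2) + 6 * B ^+ 2 * e))); last first.
  rewrite big_split /= -mulr_sumr sumr_const card_ffun !card_ord.
  rewrite -[_ *+ (K ^ k)]mulr_natl.
  have B20 : 0 <= 3 * B ^+ 2 by rewrite mulr_ge0 // sqr_ge0.
  have := ler_wpM2l B20 H1; lra.
apply: ler_sum => a _; set xi := gridpt _ a.
have xith j : `|xi j - th| <= 8.
  have xi0 : 0 <= xi j by rewrite /xi /gridpt add0r divr_ge0 // !mulr_ge0 // pi_ge0.
  have xi8 : xi j <= 8.
    rewrite /xi /gridpt add0r ler_pdivrMr ?ltr0n /K ?addnS //; apply: ler_pM => //.
    - by rewrite mulr_ge0 // pi_ge0.
    - have := @pihalf_lt2 R; lra.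
    - by rewrite ler_nat ltnW // -/K.
  by case/andP: th04 => ? ?; rewrite ler_norml; apply/andP; split; lra.
have [X1 X2] := H2 xi xith.
have Eg : ft g xi = (symbol mu xi ^+ 2 - 1)%:C * ft v xi.
  rewrite /g (ftD xi sg1 sg2) ftZ (ft_hop mu xi shv) (ft_hop mu xi sv).
  by ring.
have := ft_cutU_bound Ueq F0 N xi n; rewrite -/v.
rewrite Eg normcM normc_real.
set w := _ * normc (ft v xi); move=> Hw.
have E0 := errsum_ge0 mu U F N xi.
set E := errsum mu U F N xi in Hw E0 *.
have X1' := normc_ge0 (extrap mu F 0 1 N xi); have X2' := normc_ge0 (extrap mu F 1 0 N xi).
set a1 := normc (extrap mu F 0 1 N xi) in Hw X1 X1' *.
set a2 := normc (extrap mu F 1 0 N xi) in Hw X2 X2' *.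
have w0 : 0 <= w by rewrite mulr_ge0 ?normc_ge0.
have wB : w <= B * (E + a1 + a2).
  by apply: (le_trans Hw); apply: ler_wpM2r (symbol_le xi); lra.
have w2 : w ^+ 2 <= B ^+ 2 * (E + a1 + a2) ^+ 2.
  by rewrite -exprMn lerXn2r ?nnegrE ?(le_trans w0).
have s3 : (E + a1 + a2) ^+ 2 <= 3 * E ^+ 2 + 6 * e.
  have : a1 ^+ 2 <= e by nra.
  have : a2 ^+ 2 <= e by nra.
  have := sqr_ge0 (E - a1); have := sqr_ge0 (E - a2); have := sqr_ge0 (a1 - a2); nra.
have := ler_wpM2l (sqr_ge0 B) s3; lra.
Qed.

(** Beyond the source, [hop] is the mean of the two adjacent slices; hence
[hop (hop (U n)) = U n] becomes a recurrence along the ray through [x] alone.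
*)
Lemma second_difference (n : int) x : 1 <= n -> U (n + 2) x + U (n - 2) x = 2 * U n x.
Proof.
move=> n1.
have hopD g h y : hop mu (fun z => g z + h z) y = hop mu g y + hop mu h y.
  rewrite /hop (eq_bigr (fun j => (g (y + evec j) + g (y - evec j)) + (h (y + evec j) + h (y - evec j)))).
    by rewrite big_split /=; ring.
  by move=> j _; ring.
have eqn m y : 0 <= m -> U (m + 1) y + U (m - 1) y = 2 * hop mu (U m) y.
  by move=> m0; rewrite Ueq F0 // addr0.
have e1 := eqn (n + 1) x ltac:(lia); have e2 := eqn (n - 1) x ltac:(lia).
rewrite (_ : n + 1 + 1 = n + 2) in e1; last by lia.
rewrite (_ : n + 1 - 1 = n) in e1; last by lia.
rewrite (_ : n - 1 + 1 = n) in e2; last by lia.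
rewrite (_ : n - 1 - 1 = n - 2) in e2; last by lia.
have e3 : hop mu (U (n + 1)) x + hop mu (U (n - 1)) x = 2 * U n x.
  rewrite -hopD (_ : (fun z => _) = (fun z => hop mu (U n) z + hop mu (U n) z)).
    rewrite hopD (_ : n = `|n|%N%:Z); last by lia.
    by rewrite hop_hop; ring.
  by apply/funext => z; rewrite eqn; [ring|lia].
have -> : U (n + 2) x + U (n - 2) x =
  (U (n + 2) x + U n x) + (U n x + U (n - 2) x) - 2 * U n x by ring.
by rewrite e1 e2 -mulrDr e3; ring.
Qed.

(** Along steps of two the ray carries an affine sequence [w], for which
[w 0 = 2 w j - w (2 j)]. Averaging the squares over [j] bounds [w 0] by the
mean mass along the ray, which tends to zero. *)
Lemma slice_eq0 (n : nat) x : U n%:Z x = 0.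
Proof.
pose w j := U (n + 2 * j)%N%:Z x.
have w2 j : w j.+2 - w j.+1 = w j.+1 - w j.
  have := @second_difference (n + 2 * j.+1)%N%:Z x ltac:(lia).
  rewrite (_ : _ + 2 = (n + 2 * j.+2)%N%:Z); last by lia.
  rewrite (_ : _ - 2 = (n + 2 * j)%N%:Z); last by lia.
  rewrite -/(w j) -/(w j.+1) -/(w j.+2) => H.
  by apply/eqP; rewrite subr_eq addrAC eq_sym subr_eq H; apply/eqP; ring.
have waff j : w j = w 0%N + j%:R * (w 1%N - w 0%N).
  have d i : w i.+1 - w i = w 1%N - w 0%N by elim: i => // i <-.
  elim: j => [|j IH]; first by rewrite mul0r addr0.
  by rewrite -(subrK (w j) (w j.+1)) d IH -natr1; ring.
have w00 j : w 0%N = 2 * w j - w (2 * j)%N by rewrite (waff j) (waff (2 * j)%N) natrM; ring.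
pose q j := normc (U j%:Z x) ^+ 2.
have q0 j : 0 <= q j by exact: sqr_ge0.
have w0q j : normc (w 0%N) ^+ 2 <= 8 * q (n + 2 * j)%N + 2 * q (n + 4 * j)%N.
  have : normc (w 0%N) <= 2 * normc (w j) + normc (w (2 * j)%N).
    rewrite [in leLHS](w00 j) (le_trans (ler_normcB _ _)) // lerD2r normcM normc_nat //.
  rewrite /q /w (_ : (n + 2 * (2 * j) = n + 4 * j)%N); last by lia.
  set a := normc (U (n + 2 * j)%N%:Z x); set b := normc (U (n + 4 * j)%N%:Z x).
  have := normc_ge0 (U (n + 2 * 0)%N%:Z x); set c := normc _ => c0 cab.
  have := sqr_ge0 (2 * a - b); nra.
have qsum s J : (0 < s)%N -> \sum_(j < J) q (n + s * j.+1)%N <= \sum_(i < n + s * J + 1) q i.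
  move=> s0; elim: J => [|J IH]; first by rewrite big_ord0 sumr_ge0.
  rewrite big_ord_recr /= [leRHS](_ : _ = \sum_(i < n + s * J.+1) q i + q (n + s * J.+1)%N); last first.
    by rewrite addn1 big_ord_recr.
  rewrite lerD2r (le_trans IH) //.
  rewrite -!(big_mkord xpredT q) [leRHS](@big_cat_nat _ _ _ (n + s * J + 1)%N) //=.
    by rewrite lerDl sumr_ge0.
  by rewrite mulnS; lia.
have mass L : (supnorm x < L)%N -> \sum_(i < L) q i <= boxmass U L.
  move=> xL; pose h m := lsum (fun y => if (supnorm y < L)%N then normc (U m y) ^+ 2 else 0).
  have h0 m : 0 <= h m by apply: lsum_ge0 => y; case: ifP => // _; exact: sqr_ge0.
  apply: (@le_trans _ _ (\sum_(i < L) h (Posz i))); last first.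
    by rewrite /boxmass /zsum lerDl; apply: sumr_ge0 => i _; exact: h0.
  apply: ler_sum => i _; rewrite /q /h.
  have := @ler_lsum_pt _ _ L (fun y => if (supnorm y < L)%N then normc (U i%:Z y) ^+ 2 else 0) x.
  rewrite xL; apply=> [y|y]; first by rewrite leqNgt => /negbTE ->.
  by case: ifP => // _; exact: sqr_ge0.
suff H e : 0 < e -> normc (w 0%N) ^+ 2 <= e.
  apply: eq0_normc; apply/eqP; rewrite -sqrf_eq0 eq_le sqr_ge0 andbT.
  apply/ler_addgt0Pr => e e0; rewrite add0r (le_trans _ (H e e0)) //.
  by rewrite /w muln0 addn0.
(* [50 = 10 * 5]: the constant [8 + 2] of [w0q] and the ratio [5] between the
side of the box and the number of terms averaged. *)
move=> e0; have e50 : 0 < e / 50 by rewrite divr_gt0.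
have [L0 HL] := Umass e50.
pose J := (L0 + n + supnorm x + 1)%N; pose L := (n + 4 * J + 1 + supnorm x)%N.
have J0 : (0 : R) < J%:R by rewrite ltr0n /J addn1.
have LJ : L%:R <= 5 * J%:R :> R by rewrite -natrM ler_nat /L /J; lia.
have sub s : (s <= 4)%N -> \sum_(i < n + s * J + 1) q i <= \sum_(i < L) q i.
  move=> s4; rewrite -!(big_mkord xpredT q) [leRHS](@big_cat_nat _ _ _ (n + s * J + 1)%N) //=.
    by rewrite lerDl sumr_ge0.
  by rewrite /L; nia.
have S : \sum_(j < J) normc (w 0%N) ^+ 2 <= 10 * boxmass U L.
  apply: (@le_trans _ _ (\sum_(j < J) (8 * q (n + 2 * j.+1)%N + 2 * q (n + 4 * j.+1)%N))).
    by apply: ler_sum => j _; exact: w0q.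
  rewrite big_split /= -!mulr_sumr.
  have := mass L ltac:(rewrite /L; lia).
  have := le_trans (@qsum 2 J isT) (@sub 2 isT).
  have := le_trans (@qsum 4 J isT) (@sub 4 isT); lra.
have {}HL := HL L ltac:(rewrite /L /J; lia).
rewrite sumr_const card_ord -[_ *+ J]mulr_natl in S.
have : J%:R * normc (w 0%N) ^+ 2 <= J%:R * e.
  apply: (le_trans S); have := ler_wpM2l (ltW e50) LJ; nra.
by rewrite ler_pM2l.
Qed.

End Uniqueness.

(** It remains to exhibit a ball of real frequencies on which the symbol stays
strictly between [-1] and [1]. *)
Lemma slices_vanish (R : realType) (k : nat) (lambda : R)
    (U F : int -> 'rV[int]_k -> R[i]) :
  0 < lambda < 2 * k.+1%:R ->
  (forall n x, U (n + 1) x + U (n - 1) x = 2 * hop (2 * k.+1%:R - lambda) (U n) x + F n x) ->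
  (forall n x, 0 <= n -> F n x = 0) ->
  (forall D : R, 1 <= D ->
     exists C0 : R, forall n x, normc (F n x) * D ^+ (`|n| + onenorm x) <= C0) ->
  (forall e : R, 0 < e -> exists L0, forall L, (L0 <= L)%N -> boxmass U L <= e * L%:R) ->
  forall (n : nat) x, U n%:Z x = 0.
Proof.
move=> /andP[l0 l2] Ueq F0 Fdecay Umass.
set d : R := k.+1%:R in l2 Ueq.
have d1 : 1 <= d by rewrite ler1n.
have d0 : d != 0 by rewrite pnatr_eq0.
have dk : d = k%:R + 1 by rewrite /d natr1.
(* The diagonal frequency at which the full symbol equals [lambda] with all
[d] coordinates equal to [th]: there the symbol of the slice is [cos th = s],
which lies strictly between [0] and [1]. *)
pose s := 1 - lambda / (2 * d); pose th := acos s; pose kap := (1 - s) / 2.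
pose rho := kap / (2 * d).
have sd : 1 - s = lambda / (2 * d) by rewrite /s; ring.
have s0 : 0 < s by rewrite /s subr_gt0 ltr_pdivrMr ?mul1r //; lra.
have s1 : s < 1 by rewrite -subr_gt0 sd divr_gt0 //; lra.
have cth : cos th = s by rewrite /th acosK // in_itv /=; apply/andP; split; lra.
have kap0 : 0 < kap by rewrite /kap; lra.
have kap1 : kap <= 1 by rewrite /kap; lra.
have rho0 : 0 < rho by rewrite divr_gt0 //; lra.
have th04 : 0 <= th <= 4.
  have s11 : -1 <= s <= 1 by apply/andP; split; lra.
  rewrite acos_ge0 //= (le_trans (acos_lepi s11)) //.
  have := @pihalf_lt2 R; lra.
apply: (@slice_eq0 R k _ U F Ueq F0 Fdecay Umass th rho kap th04 rho0) => [|xi xith].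
  by rewrite kap0.
have close : `|symbol (2 * d - lambda) xi - s| <= kap.
  have -> : symbol (2 * d - lambda) xi - s = \sum_(j < k) (cos th - cos (xi j)).
    rewrite /symbol big_split /= sumrN sumr_const card_ord cth -[_ *+ k]mulr_natl.
    have -> : (2 * d - lambda) / 2 = d * s by rewrite /s; field.
    by rewrite dk; ring.
  rewrite (le_trans (ler_norm_sum _ _ _)) //.
  apply: (@le_trans _ _ (\sum_(j < k) (2 * rho))).
    by apply: ler_sum => j _; rewrite (le_trans (cos_lip _ _)) // distrC.
  rewrite sumr_const card_ord -[_ *+ k]mulr_natl.
  have -> : 2 * rho = kap / d by rewrite /rho; field.
  rewrite mulrA ler_pdivrMr; last by lra.
  by rewrite mulrC ler_wpM2l ?(ltW kap0) // dk lerDl.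
move: close; rewrite ler_norml => /andP[].
have : s = 1 - 2 * kap by rewrite /kap; field.
nra.
Qed.

(** * The Laplacian and the growth conditions on the whole lattice *)

Section Lattice.
Variables (R : realType) (d : nat).
Local Notation C := R[i].
Implicit Types x y v : lattice d.

Lemma coord_le_lnorm x j : `|x ord0 j|%N%:R <= lnorm R x.
Proof.
rewrite natr_absz intr_norm -sqrtr_sqr /lnorm ler_sqrt; last first.
  by apply: sumr_ge0 => i _; exact: sqr_ge0.
by rewrite (bigD1 j) //= lerDl; apply: sumr_ge0 => i _; exact: sqr_ge0.
Qed.

Lemma lnorm_le x : lnorm R x <= (onenorm x)%:R.
Proof.
rewrite /lnorm -[leRHS]ger0_norm // -sqrtr_sqr ler_sqrt ?sqr_ge0 //.
rewrite /onenorm natr_sum.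
have H (s : seq 'I_d) : \sum_(j <- s) ((x ord0 j)%:~R : R) ^+ 2 <= (\sum_(j <- s) `|x ord0 j|%N%:R) ^+ 2.
  elim: s => [|j s IH]; first by rewrite !big_nil expr0n.
  have -> : \sum_(j <- j :: s) `|x ord0 j|%N%:R = `|x ord0 j|%N%:R + \sum_(j <- s) (`|x ord0 j|%N%:R : R).
    by rewrite big_cons.
  have E : ((x ord0 j)%:~R : R) ^+ 2 = `|x ord0 j|%N%:R ^+ 2.
    by rewrite natr_absz intr_norm real_normK ?num_real.
  rewrite big_cons E.
  have S0 : 0 <= \sum_(j <- s) (`|x ord0 j|%N%:R : R) by apply: sumr_ge0.
  have a0 : (0 : R) <= `|x ord0 j|%N%:R by [].
  have := mulr_ge0 a0 S0; lra.
exact: H.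
Qed.

Lemma unit_lnorm v : lnorm R v = 1 <-> exists i, v = evec i \/ v = - evec i.
Proof.
have E : lnorm R v = Num.sqrt ((\sum_(j < d) (v ord0 j) ^+ 2)%:~R : R).
  by rewrite /lnorm rmorph_sum; congr Num.sqrt; apply: eq_bigr => j _; rewrite rmorphXn.
have sq0 (a : int) : 0 <= a ^+ 2 by exact: sqr_ge0.
split=> [|[i vi]]; last first.
  rewrite E (bigD1 i) //= big1 => [|j ji].
    by case: vi => ->; rewrite !mxE !eqxx ?sqrrN expr1n addr0 sqrtr1.
  by case: vi => ->; rewrite !mxE eqxx (negbTE ji) ?oppr0 expr0n.
rewrite E => /(congr1 (fun r => r ^+ 2)).
rewrite sqr_sqrtr ?ler0z ?sumr_ge0 // expr1n => /eqP.
rewrite (_ : 1 = 1%:~R) // eqr_int => /eqP S1.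
have [i vi] : exists i, v ord0 i != 0.
  apply/existsP; rewrite -[[exists _, _]]negbK negb_exists; apply/negP => /forallP H.
  move: S1; rewrite big1 // => j _; have := H j; rewrite negbK => /eqP ->.
  by rewrite expr0n.
exists i; move: S1; rewrite (bigD1 i) //=.
set S := \sum_(_ < d | _) _ => S1.
have S0 : 0 <= S by exact: sumr_ge0.
have v1 : 1 <= v ord0 i ^+ 2 by rewrite -gtz0_ge1 lt_def sq0 sqrf_eq0 vi.
have vj j : j != i -> v ord0 j = 0.
  move=> ji; apply/eqP; rewrite -sqrf_eq0; apply/eqP.
  have Sz : S = 0 by lia.
  by move/eqP: Sz; rewrite psumr_eq0 // => /allP/(_ j (mem_index_enum _)); rewrite ji => /eqP.
have : (v ord0 i == 1) || (v ord0 i == -1) by rewrite -sqrf_eq1; apply/eqP; lia.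
case/orP => /eqP vE; [left|right]; apply/rowP => j; rewrite !mxE eqxx /=.
  by case: eqVneq => [->|/vj].
by case: eqVneq => [->|/vj ->]; rewrite ?oppr0.
Qed.

Lemma laplacianE (u : lattice d -> C) x : laplacian u x =
  \sum_(i < d) ((u x - u (x + evec i)) + (u x - u (x - evec i))).
Proof.
have e_inj : injective (@evec d).
  move=> i j /rowP/(_ i); rewrite !mxE !eqxx /=; case: eqP => //.
pose s := [seq x + evec i | i <- index_enum 'I_d] ++ [seq x - evec i | i <- index_enum 'I_d].
have us : uniq s.
  rewrite cat_uniq !map_inj_uniq ?index_enum_uniq //=; last first.
  - by move=> i j /addrI/e_inj.
  - by move=> i j /addrI/oppr_inj/e_inj.
  rewrite andbT; apply/hasPn => y /mapP[i _ ->]; apply/negP => /mapP[j _].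
  move/addrI/rowP/(_ i); rewrite !mxE !eqxx /=; case: eqP => //.
rewrite /laplacian (_ : neighbours R x = [set` s]).
  by rewrite [RHS]big_split -fsbig_seq // big_cat !big_map.
apply/seteqP; split=> y /=; rewrite /neighbours /= unit_lnorm mem_cat.
  case=> i [xy|xy]; apply/orP; [right|left]; apply/mapP; exists i; rewrite ?mem_index_enum //.
    by rewrite -xy subKr.
  by rewrite -[evec i]opprK -xy subKr.
case/orP=> /mapP[i _ ->]; exists i; [right|left].
  by rewrite opprD addNKr.
by rewrite opprB addrC subrK.
Qed.

Lemma super_exp_decay_pt (f : lattice d -> C) (t : R) : 0 < t -> super_exp_decay f ->
  exists A : R, forall x, normc (f x) * expR (t * lnorm R x) <= A.
Proof.
move=> t0 /(_ t t0); rewrite /square_summable => sf.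
set g := (fun x => _) in sf.
have := sf; rewrite summableE => S.
exists (1 + fine (\esum_(x in [set: lattice d]) `|g x|%E)) => x.
have gx : (`|g x| <= \esum_(x in [set: lattice d]) `|g x|)%E.
  by apply: esum_ge; exists [set x]; [split|rewrite fsbig_set1].
move: gx; rewrite -[X in (_ <= X)%E -> _]fineK //.
set A := fine _; rewrite /g /sqmod normcM normc_real [`|expR _|]ger0_norm ?expR_ge0 //.
rewrite /= lee_fin ger0_norm ?sqr_ge0 // mulrC.
set b := normc _ * _; nra.
Qed.

Lemma mass_ge_seq (u : lattice d -> C) (r : R) (s : seq (lattice d)) :
  uniq s -> (forall x, x \in s -> lnorm R x < r) ->
  \sum_(x <- s) normc (u x) ^+ 2 <= mass u r.
Proof.
move=> us sr; rewrite /mass fsbig_seq // [leRHS](fsbigID [set` s]) /=; last exact: lball_finite.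
rewrite (_ : lball r `&` [set` s] = [set` s]); last first.
  by apply/seteqP; split=> x /=; [case|move=> xs; split=> //; exact: sr].
by rewrite lerDl; apply: sumr_ge0 => x _; exact: sqr_ge0.
Qed.

End Lattice.

Lemma zsumE (V : nmodType) L (g : int -> V) :
  zsum L g = \sum_(b < L + L) g (b%:Z - L%:Z).
Proof.
rewrite big_split_ord /= addrC; congr (_ + _).
  by apply: eq_bigr => b _; congr g; lia.
rewrite (reindex_inj rev_ord_inj) /=; apply: eq_bigr => b _.
by congr g; have := ltn_ord b; lia.
Qed.

(** * Half-spaces in an arbitrary axis direction *)

Section Embedding.
Variables (k : nat) (j0 : 'I_k.+1) (s z : int).
Hypothesis s1 : s = 1 \/ s = -1.

Definition embed (n : int) (y : 'rV[int]_k) : lattice k.+1 :=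
  \row_i (if unlift j0 i is Some i' then y ord0 i' else s * (n + z)).

Lemma embed_axis n y : embed n y ord0 j0 = s * (n + z).
Proof. by rewrite mxE unlift_none. Qed.

Lemma embed_lift n y i : embed n y ord0 (lift j0 i) = y ord0 i.
Proof. by rewrite mxE liftK. Qed.

Lemma embed_ext (x x' : lattice k.+1) : x ord0 j0 = x' ord0 j0 ->
  (forall i, x ord0 (lift j0 i) = x' ord0 (lift j0 i)) -> x = x'.
Proof. by move=> H0 H; apply/rowP => i; case: (unliftP j0 i) => [i' ->|->]. Qed.

Lemma embed_surj (x : lattice k.+1) : x = embed (s * x ord0 j0 - z) (\row_i x ord0 (lift j0 i)).
Proof.
apply: embed_ext => [|i]; last by rewrite embed_lift mxE.
by rewrite embed_axis subrK mulrA; case: s1 => ->; rewrite ?mulrNN !mul1r.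
Qed.

Lemma embed_inj n y n' y' : embed n y = embed n' y' -> n = n' /\ y = y'.
Proof.
move=> E; split; last first.
  by apply/rowP => i; rewrite -(embed_lift n y) E embed_lift.
have := congr1 (fun x : lattice k.+1 => x ord0 j0) E; rewrite !embed_axis.
by case: s1 => ->; rewrite ?mulN1r ?mul1r; lia.
Qed.

Lemma embed_evec n y i : embed n y + evec (lift j0 i) = embed n (y + evec i).
Proof.
apply: embed_ext => [|i'].
  by rewrite mxE !embed_axis mxE eqxx (negbTE (neq_lift _ _)) addr0.
by rewrite mxE !embed_lift !mxE !eqxx (inj_eq lift_inj).
Qed.

Lemma embed_evecN n y i : embed n y - evec (lift j0 i) = embed n (y - evec i).
Proof. by apply/eqP; rewrite subr_eq embed_evec subrK. Qed.

Lemma embed_step n y : embed (n + 1) y = embed n y + s *: evec j0.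
Proof.
apply: embed_ext => [|i].
  by rewrite embed_axis [RHS]mxE embed_axis !mxE !eqxx /= mulr1; ring.
by rewrite embed_lift [RHS]mxE embed_lift !mxE eqxx eq_sym (negbTE (neq_lift _ _)) mulr0 addr0.
Qed.

Lemma embed_onenorm n y : (`|n| + onenorm y <= `|z| + onenorm (embed n y))%N /\
  (onenorm (embed n y) <= `|n| + `|z| + onenorm y)%N.
Proof.
have -> : onenorm (embed n y) = (`|(n + z)%R| + onenorm y)%N.
  rewrite /onenorm (bigD1_ord j0) //= embed_axis; congr (_ + _)%N.
    by case: s1 => ->; lia.
  by apply: eq_bigr => i _; rewrite embed_lift.
by split; lia.
Qed.

Variables (R : realType) (lambda : R) (u f : lattice k.+1 -> R[i]).

Lemma embed_equation :
  (forall x, laplacian u x - lambda%:C * u x = f x) -> forall n y,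
  u (embed (n + 1) y) + u (embed (n - 1) y) =
  2 * hop (2 * k.+1%:R - lambda) (fun y => u (embed n y)) y + (- f (embed n y)).
Proof.
move=> ueq n y; rewrite -ueq laplacianE (bigD1_ord j0) //=.
have -> : u (embed (n + 1) y) + u (embed (n - 1) y) =
    u (embed n y + evec j0) + u (embed n y - evec j0).
  have En : embed (n - 1) y = embed n y - s *: evec j0.
    by rewrite -[in RHS](subrK 1 n) embed_step addrK.
  by rewrite embed_step En; case: s1 => ->; rewrite ?scaleN1r ?scale1r ?opprK // addrC.
rewrite (eq_bigr (fun i => 2 * u (embed n y) -
  (u (embed n (y + evec i)) + u (embed n (y - evec i))))); last first.
  by move=> i _; rewrite embed_evec embed_evecN; ring.
rewrite sumrB sumr_const card_ord -[_ *+ k]mulr_natl /hop.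
rewrite -natr1 !rmorphM rmorphB rmorphM rmorphD /= !rmorph_nat rmorph1.
set S := \sum_(_ < k) _.
have -> : (2^-1 : R)%:C = 2^-1 :> R[i] by rewrite fmorphV rmorph_nat.
by field.
Qed.

Lemma embed_decay : super_exp_decay f -> forall D : R, 1 <= D ->
  exists C0 : R, forall n y,
    normc (- f (embed n y)) * D ^+ (`|n| + onenorm y) <= C0.
Proof.
move=> hf D D1; have D0 : 0 < D by lra.
pose t := k.+1%:R * ln D + 1.
have lnD : 0 <= ln D by rewrite ln_ge0.
have t0 : 0 < t by rewrite ltr_wpDl // mulr_ge0.
have [A HA] := super_exp_decay_pt t0 hf.
exists (A * D ^+ `|z|) => n y; set x := embed n y.
have [xn _] := embed_onenorm n y.
have L0 : 0 <= lnorm R x by exact: sqrtr_ge0.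
have xl : (onenorm x)%:R <= k.+1%:R * lnorm R x.
  rewrite /onenorm natr_sum -[X in X%:R * _](card_ord k.+1) mulr_natl -sumr_const.
  by apply: ler_sum => j _; exact: coord_le_lnorm.
have DX : D ^+ onenorm x <= expR (t * lnorm R x).
  rewrite -[D in leLHS](lnK (x := D)) ?posrE // -expRM_natl ler_expR.
  rewrite /t mulrDl mul1r (le_trans (ler_wpM2r lnD xl)) // mulrAC lerDl //.
rewrite normcNE (le_trans _ (ler_wpM2r _ (HA x))) ?exprn_ge0 ?(ltW D0) //.
rewrite -mulrA ler_wpM2l ?normc_ge0 //.
rewrite (le_trans (ler_weXn2l D1 xn)) // exprD mulrC ler_wpM2r // exprn_ge0 // ltW //.
Qed.

Lemma embed_mass : (mass u =o_ (at_pinfty R) id) -> forall e : R, 0 < e ->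
  exists L0, forall L, (L0 <= L)%N -> boxmass (fun n y => u (embed n y)) L <= e * L%:R.
Proof.
move=> hu e e0.
(* The image of the cube of side [L + L] lies in the ball of radius [c * L] as
soon as [L] exceeds [|z|]. *)
pose c : R := 2 * k.+2%:R.
have c0 : 0 < c by rewrite mulr_gt0 // ltr0n.
have ec : 0 < e / c by rewrite divr_gt0.
have /eqoP/(_ _ ec) := hu.
case=> r0 [_ Hr].
exists (`|z| + (Num.truncn `|r0|).+1)%N => L LL.
pose r := c * L%:R.
have L0 : (0 < L)%N by lia.
have L1 : (1 : R) <= L%:R by rewrite ler1n.
have rr0 : r0 < r.
  apply: (@le_lt_trans _ _ `|r0|); first exact: ler_norm.
  apply: (lt_le_trans (truncnS_gt _)); apply: (@le_trans _ _ L%:R).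
    by rewrite ler_nat; apply: leq_trans LL; exact: leq_addl.
  by rewrite /r ler_peMl // /c -natrM ler1n.
have rp : 0 < r by rewrite mulr_gt0 // ltr0n.
have -> : e * L%:R = e / c * `|r|.
  by rewrite ger0_norm ?(ltW rp) // /r; field; rewrite gt_eqF.
apply: le_trans (Hr r rr0).
apply: le_trans (ler_norm _).
pose pt (b : 'I_(L + L)) (i : {ffun 'I_k -> 'I_(L + L)}) := embed (b%:Z - L%:Z) (boxpt i).
pose pts := [seq pt b i | b <- index_enum 'I_(L + L), i <- index_enum {ffun 'I_k -> 'I_(L + L)}].
apply: (@le_trans _ _ (\sum_(x <- pts) normc (u x) ^+ 2)).
  rewrite /pts big_allpairs_dep /boxmass zsumE; apply: ler_sum => b _.
  rewrite (@lsumE _ _ L); last by move=> x; rewrite leqNgt => /negbTE ->.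
  by apply: ler_sum => i _; case: ifP => // _; exact: sqr_ge0.
apply: mass_ge_seq.
  apply: allpairs_uniq; rewrite ?index_enum_uniq // => -[b i] [b' i'] _ _ /=.
  case/embed_inj => /addIr [bb] /boxpt_inj ->; congr pair; exact: val_inj.
move=> x /allpairsP[[b i] /= [_ _ ->]].
apply: (le_lt_trans (lnorm_le _ _)).
have [_ xn] := embed_onenorm (b%:Z - L%:Z) (boxpt i).
have bL : (`|(b%:Z - L%:Z)%R| <= L)%N by have := ltn_ord b; lia.
have iL : (onenorm (@boxpt k L i) <= k * L)%N.
  rewrite -[X in (_ <= X * _)%N](card_ord k) -sum_nat_const; apply: leq_sum => j _.
  by rewrite mxE; move: (ltn_ord (i j)); move: (nat_of_ord (i j)) => q; lia.
rewrite /r /c -!natrM ltr_nat (leq_ltn_trans xn) //.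
nia.
Qed.

Hypothesis hlambda : 0 < lambda < 2 * k.+1%:R.
Hypothesis hu : mass u =o_ (at_pinfty R) id.
Hypothesis ueq : forall x, laplacian u x - lambda%:C * u x = f x.
Hypothesis hf : super_exp_decay f.

Lemma halfspace_vanish : (forall x : lattice k.+1, z <= s * x ord0 j0 -> f x = 0) ->
  forall x : lattice k.+1, z <= s * x ord0 j0 -> u x = 0.
Proof.
move=> f0 x zx; rewrite (embed_surj x).
have -> : s * x ord0 j0 - z = (`|(s * x ord0 j0 - z)%R|%N)%:Z by rewrite gez0_abs // subr_ge0.
move: (`|_|%N) (\row_i _) => n y.
apply: (slices_vanish hlambda (embed_equation ueq) _ (embed_decay hf) (embed_mass hu) n y).
move=> m y' m0; rewrite f0 ?oppr0 // embed_axis mulrA.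
by case: s1 => ->; rewrite ?mulrNN !mul1r lerDr.
Qed.

End Embedding.

Theorem theorem1p2 (R : realType) (d : nat) (hd : (0 < d)%N)
    (lambda : R) (hlambda : 0 < lambda < 2 * d%:R)
    (u f : lattice d -> R[i])
    (hu : mass u =o_ (at_pinfty R) id)
    (heq : forall x : lattice d, laplacian u x - lambda%:C * u x = f x)
    (hf : super_exp_decay f) :
  (forall z : int,
     (forall x, halfspace (last_coord hd) z x -> f x = 0) ->
     forall x, halfspace (last_coord hd) z x -> u x = 0)
  /\
  (forall m : 'I_d -> nat,
     (forall x, (~` cuboid m) x -> f x = 0) ->
     forall x, (~` cuboid m) x -> u x = 0).
Proof.
case: d hd hlambda u f hu heq hf => // k hd hlambda u f hu heq hf.
have vanish j s z (s1 : s = 1 \/ s = -1) := @halfspace_vanish k j s z s1 R lambda u f hlambda hu heq hf.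
split=> [z f0 x xz|m f0 x].
  apply: (vanish (last_coord hd) 1 z (or_introl erefl)); rewrite ?mul1r // => y.
  by rewrite mul1r; exact: f0.
move=> /existsNP[j] /negP; rewrite negb_and -!ltNge => /orP[xj|xj].
  apply: (vanish j (- 1) 1 (or_intror erefl)); last by rewrite mulN1r; lia.
  move=> y yj; apply: f0 => /(_ j) /andP[y0 _].
  by move: yj; rewrite mulN1r; lia.
apply: (vanish j 1 ((m j)%:Z + 1) (or_introl erefl)); last by rewrite mul1r; lia.
move=> y yj; apply: f0 => /(_ j) /andP[_ ym].
by move: yj; rewrite mul1r; lia.
Qed.
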